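(* Let $\ell\ge 3$ and let $\widetilde C$ be an orientation of the cycle $C_\ell$ which is not consistently directed. For every $\mu>0$ there exist constants $\gamma>0$ and $n_0\in\mathbb N$ such that the following holds. If $n\ge n_0$, $\ell\mid n$, and $D$ is an $n$-vertex oriented graph satisfying $$\alpha(D)\le\gamma n\qquad\text{and}\qquad \sigma_{\mathrm{Ore}}^*(D)\ge\left(\frac34+\mu\right)n,$$ then $D$ contains a $\widetilde C$-factor.
   Context: An oriented graph is a finite digraph obtained by assigning a direction to each edge of a simple graph (no loops, at most one arc between any two vertices). $A(D)$ is the arc set of $D$. $\alpha(D)$ is the independence number of the underlying undirected graph of $D$. $d_D^+(v),d_D^-(v)$ are the out- and in-degree, and $d_D^*(v):=\max\{d_D^+(v),d_D^-(v)\}$. Define $$\sigma_{\mathrm{Ore}}^*(D):=\min\{d_D^*(x)+d_D^*(y): x\ne y,\ xy,yx\notin A(D)\},$$ with $\sigma_{\mathrm{Ore}}^*(D)=\infty$ if the underlying graph of $D$ is complete. An orientation of $C_\ell$ is consistently directed (a directed cycle) if every vertex has in-degree $1$ and out-degree $1$. An $H$-factor of $D$ is a set of pairwise vertex-disjoint (not necessarily induced) copies of $H$ in $D$ covering all of $V(D)$. *)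

(* Defs.v *)
From mathcomp Require Import all_boot all_order all_algebra.
From mathcomp Require Import constructive_ereal reals.

Set Implicit Arguments.
Unset Strict Implicit.
Unset Printing Implicit Defensive.

Import Order.TTheory GRing.Theory Num.Theory.

(* A digraph with vertex set T is given by its arc relation [D : rel T]:
   [D x y] means that xy is an arc. *)

Section Digraphs.
Variable T : finType.
Implicit Types (D adj : rel T) (v : T) (A : {set T}).

Definition oriented_graph D : Prop :=
  irreflexive D /\ forall x y, D x y -> ~~ D y x.

Definition underlying D : rel T := [rel x y | D x y || D y x].

Definition independent adj A : bool :=
  [forall x in A, forall y in A, ~~ adj x y].

Definition independence_number adj : nat :=
  \max_(A : {set T} | independent adj A) #|A|.

Definition outdeg D v : nat := #|[set w | D v w]|.
Definition indeg D v : nat := #|[set w | D w v]|.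
Definition stardeg D v : nat := maxn (outdeg D v) (indeg D v).

Definition sigma_ore_star (R : realType) D : \bar R :=
  \big[Order.min/+oo%E]_(p : T * T | (p.1 != p.2) && ~~ underlying D p.1 p.2)
    ((stardeg D p.1 + stardeg D p.2)%N%:R%:E)%R.

Definition consistently_directed D : Prop :=
  forall v, indeg D v = 1 /\ outdeg D v = 1.

End Digraphs.

(* C_l has vertex set {0, ..., l-1}, and i is joined to i + 1 mod l.  It is the
   usual cycle only for l >= 3. *)
Definition cycle_graph (l : nat) : rel 'I_l :=
  [rel i j | (j == ordS i) || (i == ordS j)].
Arguments cycle_graph l : clear implicits.

Definition cycle_orientation (l : nat) (C : rel 'I_l) : Prop :=
  oriented_graph C /\ underlying C =2 cycle_graph l.

Section Factors.
Variables S T : finType.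
Implicit Types (H : rel S) (D : rel T) (f : {ffun S -> T}).

(* A (not necessarily induced) copy of H in D is represented by an injective
   arc-preserving map f; its vertex set is [codom f]. *)
Definition is_copy H D f : Prop :=
  injective f /\ forall x y, H x y -> D (f x) (f y).

Definition has_factor H D : Prop :=
  exists F : {set {ffun S -> T}},
    [/\ forall f, f \in F -> is_copy H D f,
        forall f g, f \in F -> g \in F -> f != g ->
          [disjoint codom f & codom g]
      & forall v, exists2 f, f \in F & v \in codom f].

End Factors.

(* Main.v *)
Require Import Defs.
From mathcomp Require Import all_boot all_order all_algebra.
From mathcomp Require Import constructive_ereal reals.
From mathcomp Require Import zify.

Set Implicit Arguments.
Unset Strict Implicit.
Unset Printing Implicit Defensive.

(** Since alpha(D) is sublinear, every linear-sized set W contains paths of any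
    prescribed orientation.  As the cycle is not consistently directed it has a
    source and a sink, so a vertex x together with such a path inside a linear
    out- or in-neighbourhood of x is a copy of the cycle.

    Absorption.  Two vertices are reachable if there are robustly many bounded
    sets that become tileable when either vertex is added; by pigeonhole on
    common neighbourhoods there are boundedly many reachability classes.  Classes
    joined to a common class by a dense set of arcs merge.  The Ore condition
    with constant 3/4 forces dense arcs across every linear cut, which leaves
    either one class or two sparse classes X, Y carrying almost all arcs; in the
    latter case the degrees exceed 3/8 n > |Y|/2, copies meeting X in one and
    in two vertices coexist, and X merges with Y.  Hence almost all vertices are
    in one class V, and each l-set of V has private absorbers.

    Instead of a random absorbing set, a reservoir Z in V is interleaved with
    dummy vertices B, and every l-subset of every window of 2l consecutive terms
    receives its own absorber.  Whatever part of Z is used up, the remaining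
    terms can be grouped l by l inside windows, hence be absorbed.

    Finally, a maximal tiling of the other vertices leaves O(alpha(D)) vertices,
    because otherwise some tile has two vertices of large degree into the
    leftover (3/8 > 1/3) and can be replaced by two tiles; the leftover is
    covered by stars whose paths lie in Z. *)

(** * Paths of prescribed orientation in sets that are large against the independence number *)

Section Digraph.
Variables (T : finType) (D : rel T).
Hypothesis oD : oriented_graph D.
Implicit Types (A B W : {set T}) (b : bool) (x y z : T).

(** The Boolean records the direction, [true] for out and [false] for in, so that one statement
    serves both kinds of neighbourhood. *)
Definition signed_arc b x y := if b then D x y else D y x.
Definition nbr b x : {set T} := [set y | signed_arc b x y].
Definition nbrs x : {set T} := [set y | underlying D x y].

Lemma arcxx b x : signed_arc b x x = false.
Proof. by case: oD => irr _; rewrite /signed_arc irr; case: b. Qed.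

Lemma arcN b x y : signed_arc (~~ b) x y = signed_arc b y x.
Proof. by case: b. Qed.

Lemma arc_asym b x y : signed_arc b x y -> ~~ signed_arc b y x.
Proof. by case: oD => _ asym; case: b => /= /asym. Qed.

Lemma nbrsE x : nbrs x = nbr true x :|: nbr false x.
Proof. by apply/setP => y; rewrite !inE. Qed.

Lemma underlyingC x y : underlying D x y = underlying D y x.
Proof. by rewrite /underlying /= orbC. Qed.

Lemma underlyingxx x : underlying D x x = false.
Proof. by rewrite /underlying /=; case: oD => irr _; rewrite irr. Qed.

Lemma nbr_sub b x : nbr b x \subset nbrs x.
Proof. by rewrite nbrsE; case: b; rewrite ?subsetUl ?subsetUr. Qed.

Lemma independent_card A : independent (underlying D) A ->
  #|A| <= independence_number (underlying D).
Proof. by move=> iA; apply: (leq_bigmax_cond (F := fun A => #|A|)). Qed.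

(* Deleting a vertex of at most average degree, together with its neighbours,
   removes at most 2d + 1 vertices. *)
Lemma sparse_independent (d : nat) (p : T -> {set T}) A :
  (forall x, x \in A -> #|p x| <= d) ->
  (forall x y, x \in A -> y \in A -> D x y -> (x \in p y) || (y \in p x)) ->
  #|A| <= (2 * d + 1) * independence_number (underlying D).
Proof.
move=> pd Ap.
suff [B [BA iB cB]] : exists B : {set T}, [/\ B \subset A,
    independent (underlying D) B & #|A| <= (2 * d + 1) * #|B|].
  by apply: leq_trans cB _; rewrite leq_mul2l (independent_card iB) orbT.
have [k] := ubnP #|A|; elim: k A pd Ap => // k IH A pd Ap ltAk.
have [->|[x0 x0A]] := set_0Vmem A.
  exists set0; split; rewrite ?sub0set ?cards0 ?muln0 //.
  by apply/forallP => x; rewrite inE.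
(* [cf x] contains every neighbour of [x] inside [A]. Its average size over [A] is at most [2 * d],
   since each membership [x \in p y] is counted once from either end. *)
pose cf x := [set y in A | (x \in p y) || (y \in p x)].
have [x xA cfx] : exists2 x, x \in A & #|cf x| <= 2 * d.
  apply/exists_inP; apply: contraT; rewrite negb_exists_in => /forall_inP big.
  have lo : \sum_(x in A) (2 * d + 1) <= \sum_(x in A) #|cf x|.
    by apply: leq_sum => x xA; have := big _ xA; lia.
  have hi : \sum_(x in A) #|cf x| <= \sum_(x in A) (d + d).
    have cfle x : #|cf x| <= \sum_(y in A) (x \in p y) + #|p x|.
      apply: leq_trans (_ : #|[set y in A | x \in p y] :|: p x| <= _).
        by apply: subset_leq_card; apply/subsetP=> y; rewrite !inE; case: (y \in A).
      apply: leq_trans (leq_card_setU _ _) _; rewrite leq_add2r.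
      rewrite -sum1_card big_mkcond [X in _ <= X]big_mkcond leq_sum //= => y _.
      by rewrite inE; case: (y \in A) => //=; case: (_ \in _).
    apply: (@leq_trans (\sum_(x in A) (\sum_(y in A) (x \in p y) + #|p x|))).
      exact: leq_sum.
    rewrite big_split [X in _ <= X]big_split leq_add //=; last exact: leq_sum.
    rewrite exchange_big leq_sum //= => y yA.
    apply: leq_trans (pd _ yA); rewrite -sum1_card.
    rewrite big_mkcond [X in _ <= X]big_mkcond leq_sum //= => x _.
    by case: (x \in A); case: (_ \in _).
  have := leq_trans lo hi; rewrite !sum_nat_const leq_mul2l.
  have -> : (#|A| == 0) = false by apply/negbTE; rewrite cards_eq0; apply/set0Pn; exists x0.
  by move=> /=; lia.
pose A' := A :\: (x |: cf x).
have A'A : A' \subset A by rewrite subsetDl.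
have cA : #|A| <= #|A'| + (2 * d + 1).
  have := cardsID (x |: cf x) A; rewrite -/A'.
  have := subset_leq_card (subsetIr A (x |: cf x)).
  have : #|x |: cf x| <= 1 + #|cf x| by rewrite cardsU1; case: (_ \notin _).
  by lia.
have ltA' : #|A'| < k.
  have : A' \proper A.
    by rewrite properE A'A; apply/subsetPn; exists x; rewrite // !inE eqxx.
  by move/proper_card; lia.
have [|||B [BA' iB cB]] // := IH A'.
- by move=> y yA'; apply: pd; apply: (subsetP A'A).
- by move=> y z yA' zA'; apply: Ap; apply: (subsetP A'A).
have xB : x \notin B.
  by apply/negP => /(subsetP BA'); rewrite !inE eqxx.
exists (x |: B); split.
- by rewrite subUset sub1set xA (subset_trans BA').
- have key y : y \in B -> ~~ underlying D x y.
    move=> yB; have := subsetP BA' _ yB; rewrite !inE negb_or -andbA.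
    case/and3P => _ ncf yA; apply: contra ncf; rewrite yA /= /underlying /=.
    by case/orP => [/(Ap _ _ xA yA)|/(Ap _ _ yA xA)] //; rewrite orbC.
  apply/forall_inP => y; rewrite !inE => /orP[/eqP->|yB]; apply/forall_inP => z.
    by rewrite !inE => /orP[/eqP->|/key //]; rewrite underlyingxx.
  rewrite !inE => /orP[/eqP->|zB]; first by rewrite underlyingC key.
  by move/forall_inP: iB => /(_ _ yB)/forall_inP/(_ _ zB).
- rewrite cardsU1 xB; nia.
Qed.

(** The word [w] prescribes the direction of each arc; [p] lists the vertices after the starting
    vertex [x]. *)
Fixpoint wpath x (w : seq bool) (p : seq T) : bool :=
  match w, p with
  | [::], [::] => true
  | b :: w', y :: p' => signed_arc b x y && wpath y w' p'
  | _, _ => false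
  end.

Lemma wpath_size x w p : wpath x w p -> size p = size w.
Proof. by elim: w x p => [|b w IH] x [|y p] //= /andP[_ /IH->]. Qed.

Lemma wpath_nth x w p (x0 : T) t : wpath x w p -> t < size w ->
  signed_arc (nth true w t) (nth x0 (x :: p) t) (nth x0 p t).
Proof.
elim: w x p t => [|b w IH] x [|y p] [|t] //= /andP[] //.
by move=> _ wp; apply: IH.
Qed.

(* The vertices of W from which no path for the word w starts are few by
   induction.  Among the others G, an arc z -> y can fail to extend the path
   chosen from y only if z lies on that path, so that G would be sparse. *)
Lemma wpath_exists (w : seq bool) W :
  size w ^ 2 * independence_number (underlying D) < #|W| ->
  exists x p, [/\ wpath x w p, uniq (x :: p) & all [in W] (x :: p)].
Proof.
elim: w W => [|b w IH] W /=.
  by rewrite mul0n card_gt0 => /set0Pn[x xW]; exists x, [::]; rewrite /= xW.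
set a := independence_number _; set m := size w => ltW.
pose good y (p : m.-tuple T) := [&& wpath y w p, uniq (y :: p) & all [in W] (y :: p)].
pose G := [set y in W | [exists p, good y p]].
have GW : G \subset W by apply/subsetP => y; rewrite inE => /andP[].
have cWG : #|W :\: G| <= m ^ 2 * a.
  rewrite leqNgt; apply/negP => /IH[x [p [wp up /allP inWG]]].
  have /setDP[xW] := inWG x (mem_head _ _); rewrite inE xW /=.
  apply/negP/negPn/existsP.
  have sp : size p == m by rewrite (wpath_size wp).
  exists (Tuple sp); rewrite /good wp up; apply/allP => z zp.
  by have /setDP[] := inWG z zp.
(* One path is fixed for each [y]. The default [set0] never occurs for [y] in [G]. *)
pose pf y : {set T} := if [pick p | good y p] is Some p then [set z in p] else set0.
have pfd y : y \in G -> #|pf y| <= m.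
  rewrite /pf; case: pickP => [p _ _|_ _]; last by rewrite cards0.
  by rewrite cardsE; apply: leq_trans (card_size _) _; rewrite size_tuple.
have [/exists_inP[z zG /exists_inP[y yG /andP[azy zpf]]]|no] :=
    boolP [exists z in G, exists y in G, signed_arc b z y && (z \notin pf y)].
  move: zpf; rewrite /pf; case: pickP => [p /and3P[wp up aW]|none].
    rewrite inE => zp; exists z, (y :: p); split => /=.
    - by rewrite azy.
    - rewrite [_ && uniq p]up andbT inE negb_or zp andbT.
      by apply: contraTneq azy => ->; rewrite arcxx.
    - by move: aW => /= ->; rewrite andbT; apply: (subsetP GW).
  by move: yG; rewrite inE => /andP[_ /existsP[p]]; rewrite none.
have /(sparse_independent pfd) : forall x y, x \in G -> y \in G -> D x y ->
    (x \in pf y) || (y \in pf x).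
  have key x y : x \in G -> y \in G -> signed_arc b x y -> x \in pf y.
    move=> xG yG axy; apply: contraNT no => npf.
    by apply/exists_inP; exists x => //; apply/exists_inP; exists y; rewrite // axy.
  move=> x y xG yG dxy; case: (b) key => key.
    by rewrite (key x y).
  by rewrite (key y x) ?orbT.
rewrite -/a => cG.
have := cardsID G W; have := subset_leq_card (subsetIr W G).
by rewrite (setIidPr GW); move: ltW cWG cG; rewrite !expnS expn0 => *; nia.
Qed.

End Digraph.

(** * Orientations of the cycle, read as cyclic words *)

Section Cycle.
Variables (l : nat) (C : rel 'I_l).
Hypotheses (l3 : 3 <= l) (oC : cycle_orientation C).

Lemma iter_ordS (i : 'I_l) k : iter k (@ordS l) i = (i + k) %% l :> nat.
Proof.
elim: k => [|k IH] /=; first by rewrite addn0 modn_small.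
by rewrite IH -[X in X %% _ = _]addn1 modnDml addn1 addnS.
Qed.

Lemma iter_ordS_inj (i : 'I_l) s t : s < l -> t < l ->
  iter s (@ordS l) i = iter t (@ordS l) i -> s = t.
Proof.
move=> sl tl /(congr1 val) /=; rewrite !iter_ordS => /eqP.
by rewrite eqn_modDl !modn_small // => /eqP.
Qed.

Lemma iter_ordS_neq (i : 'I_l) k : 0 < k < l -> iter k (@ordS l) i != i.
Proof.
case/andP => k0 kl; apply/eqP => /(@iter_ordS_inj i k 0 kl).
by move=> k00; rewrite k00 // in k0; lia.
Qed.

Lemma iter_ordSP (i j : 'I_l) : exists2 k, k < l & j = iter k (@ordS l) i.
Proof.
have l0 : 0 < l by lia.
exists ((j + (l - i)) %% l); first by rewrite ltn_mod.
apply: ord_inj; rewrite /= iter_ordS modnDmr.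
have -> : i + (j + (l - i)) = j + l by have := ltn_ord i; lia.
by rewrite modnDr modn_small.
Qed.

Lemma ordS_neq (i : 'I_l) : ordS i != i.
Proof. by apply: (@iter_ordS_neq i 1); lia. Qed.

Lemma cycle_arc i j : C i j || C j i -> j = ordS i \/ i = ordS j.
Proof.
case: oC => _ /(_ i j); rewrite /underlying /cycle_graph /= => ->.
by case/orP => /eqP; [left|right].
Qed.

Definition forward i := C i (ordS i).

Lemma arc_forward b i : signed_arc C b i (ordS i) = (forward i == b).
Proof.
case: oC => -[_ asym] /(_ i (ordS i)); rewrite /underlying /cycle_graph /= eqxx /=.
rewrite /forward; have := asym i (ordS i); case: b; rewrite /signed_arc.
  by case: (C i _).
by case: (C i _) => [/(_ isT)/negbTE->|_ /= ->].
Qed.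

Lemma arc_backward b i : signed_arc C b (ordS i) i = (forward i == ~~ b).
Proof. by rewrite -arc_forward arcN. Qed.

Lemma forward_invariant c : (forall i, forward i = c -> forward (ordS i) = c) ->
  forall i j, forward i = c -> forward j = c.
Proof.
move=> inv i j fi; have [k _ ->] := iter_ordSP i j.
by elim: k => //= k; apply: inv.
Qed.

Lemma forward_const c : (forall i, forward i = c) -> consistently_directed C.
Proof.
move=> fc v.
have nE b : [set w | signed_arc C b v w] = [set if b == c then ordS v else ord_pred v].
  apply/setP => w; rewrite !inE; apply/idP/eqP.
    move=> avw; have : C v w || C w v by move: avw; case: (b) => /= ->; rewrite ?orbT.
    case/cycle_arc => e.
      by move: avw; rewrite e arc_forward fc eq_sym => ->.
    move: avw; rewrite e arc_backward fc ordSK; case: (b) (c) => [] [] //.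
  case: eqP => [->|/eqP bc] ->; first by rewrite arc_forward fc eqxx.
  by rewrite -{1}[v]ord_predK arc_backward fc; case: (b) (c) bc => [] [].
have := nE true; have := nE false; rewrite /indeg /outdeg /= => -> ->.
by rewrite !cards1.
Qed.

Hypothesis nC : ~ consistently_directed C.

(* For b = true the vertex ordS i is a source, for b = false a sink. *)
Lemma turn b : exists i, forward i = ~~ b /\ forward (ordS i) = b.
Proof.
have [/existsP[i /andP[/eqP fi /eqP fSi]]|] :=
    boolP [exists i, (forward i == ~~ b) && (forward (ordS i) == b)]; first by exists i.
rewrite negb_exists => /forallP no; exfalso; apply: nC.
have inv i : forward i = ~~ b -> forward (ordS i) = ~~ b.
  by move=> fi; have := no i; rewrite fi eqxx; case: (forward _) (b) => [] [].
have [/existsP[i /eqP fi]|] := boolP [exists i, forward i == ~~ b].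
  by apply: (@forward_const (~~ b)) => j; apply: (forward_invariant inv j fi).
rewrite negb_exists => /forallP nob; apply: (@forward_const b) => i.
by have := nob i; case: (forward _) (b) => [] [].
Qed.

(** Such an [I] can be embedded separately from the rest of the cycle, provided that the rest goes
    into the common [b]-neighbourhood of its image. *)
Definition core b (I : {set 'I_l}) :=
  forall i j, i \in I -> j \notin I -> C i j || C j i -> signed_arc C b i j.

Lemma core1 b : exists i0, core b [set i0].
Proof.
have [i [fi fSi]] := turn b; exists (ordS i) => k j.
rewrite !inE => /eqP-> _ /cycle_arc[->|/ordS_inj<-].
  by rewrite arc_forward fSi.
by rewrite arc_backward fi.
Qed.

(* Either some arc leaves both of its neighbours on the outside pointing away
   (for b = true), or the orientation alternates around a source and there is
   a second source at distance two. *)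
Lemma core2 b : exists p q, p != q /\ core b [set p; q].
Proof.
have [/existsP[i /andP[/eqP fi /eqP fSi]]|] :=
    boolP [exists i, (forward i == ~~ b) && (forward (ordS (ordS i)) == b)].
  exists (ordS i), (ordS (ordS i)); split; first by rewrite eq_sym ordS_neq.
  move=> k j; rewrite !inE negb_or => kE /andP[j1 j2] /cycle_arc.
  case/orP: kE => /eqP->; case.
  - by move=> e; rewrite e eqxx in j2.
  - by move/ordS_inj <-; rewrite arc_backward fi.
  - by move=> ->; rewrite arc_forward fSi.
  - by move/ordS_inj => e; rewrite e eqxx in j1.
rewrite negb_exists => /forallP no.
have inv2 i : forward i = ~~ b -> forward (ordS (ordS i)) = ~~ b.
  by move=> fi; have := no i; rewrite fi eqxx; case: (forward _) (b) => [] [].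
have inv k i : forward i = ~~ b -> forward (iter (2 * k) (@ordS l) i) = ~~ b.
  move=> fi; elim: k => // k; rewrite mulnS iterD => IH.
  exact: inv2.
have [i [fi f1]] := turn b.
pose i1 := ordS i; pose i2 := ordS i1; pose i3 := ordS i2.
have f2 : forward i2 = ~~ b by exact: inv2.
have f3 : forward i3 = b.
  apply/eqP; apply: contraT => nf3.
  (* Going on from [i3] by [2 * l.-1] steps, which is minus two modulo [l], leads back to [i1],
     where the word has the value [b]. *)
  have /(inv l.-1) : forward i3 = ~~ b by case: (forward i3) (b) nf3 => [] [].
  have -> : iter (2 * l.-1) (@ordS l) i3 = i1.
    apply: ord_inj; rewrite iter_ordS -[i3]/(iter 2 (@ordS l) i1) iter_ordS modnDml.
    have -> : i1 + 2 + 2 * l.-1 = i1 + 2 * l by lia.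
    by rewrite addnC modnMDl modn_small.
  by rewrite f1; case: (b).
have i31 : i3 != i1 by rewrite -[i3]/(iter 2 (@ordS l) i1) iter_ordS_neq //; lia.
exists i1, i3; split; first by rewrite eq_sym.
move=> k j; rewrite !inE negb_or => kE _ /cycle_arc.
case/orP: kE => /eqP->; case.
- by move=> ->; rewrite arc_forward f1.
- by move/ordS_inj <-; rewrite arc_backward fi.
- by move=> ->; rewrite arc_forward f3.
- by move/ordS_inj <-; rewrite arc_backward f2.
Qed.

End Cycle.

(** * Copies of the cycle through one or two given vertices *)

Section Embedding.
Variables (l : nat) (C : rel 'I_l).
Hypotheses (l3 : 3 <= l) (oC : cycle_orientation C) (nC : ~ consistently_directed C).
Variables (T : finType) (D : rel T).
Hypothesis oD : oriented_graph D.
Implicit Types (W X P : {set T}).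

(** The path left after deleting a vertex of the cycle has [l - 2] arcs, so [wpath_exists] provides
    it in every set with at least this many vertices. *)
Definition path_threshold := (l ^ 2 * independence_number (underlying D)).+1.
Local Notation thr := path_threshold.

(** Deleting [i0] cuts the cycle open into a path, whose directions, read from the successor of [i0]
    on, form a word of length [l - 2]. *)
Lemma cycle_minus_vertex (i0 : 'I_l) W : thr <= #|W| ->
  exists h : 'I_l -> T,
    [/\ {in [set~ i0] &, injective h}, forall j, j != i0 -> h j \in W
      & forall i j, i != i0 -> j != i0 -> C i j -> D (h i) (h j)].
Proof.
move=> cW; have l0 : 0 < l by lia.
pose ds t := iter t (@ordS l) i0.
pose w := mkseq (fun t => forward C (ds t.+1)) (l - 2).
have [|x [p [wp up aW]]] := @wpath_exists _ _ oD w W.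
  apply: leq_trans cW; rewrite ltnS leq_mul2r size_mkseq.
  by apply/orP; right; rewrite leq_exp2r //; lia.
have sp : size p = l - 2 by rewrite (wpath_size wp) size_mkseq.
have pos (j : 'I_l) : {k : 'I_l | j == ds k}.
  by apply: sigW; have [t tl e] := iter_ordSP l3 i0 j; exists (Ordinal tl); rewrite e.
pose ps j : nat := sval (pos j).
have psl j : ps j < l by rewrite /ps.
have psE j : j = ds (ps j) by rewrite /ps; case: (pos j) => k /= /eqP.
have ps0 j : j != i0 -> 0 < ps j.
  by rewrite lt0n; apply: contraNneq => e; rewrite [j]psE e.
have psI j t : t < l -> j = ds t -> ps j = t.
  by move=> tl e; apply: (@iter_ordS_inj _ i0) => //; rewrite -/(ds _) -psE e.
(* Position 1 on the cycle, counted from [i0], is index 0 on the path. At [i0] itself the value is a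
   mere default. *)
pose h j := nth x (x :: p) (ps j).-1.
have szh j : j != i0 -> (ps j).-1 < size (x :: p).
  by move=> /ps0 j0; have := psl j; rewrite /= sp; lia.
exists h; split.
- move=> i j; rewrite !inE => ni nj /eqP; rewrite nth_uniq ?szh // => /eqP e.
  rewrite [i]psE [j]psE; congr ds.
  by have := ps0 _ ni; have := ps0 _ nj; lia.
- by move=> j nj; apply: (allP aW); rewrite mem_nth ?szh.
- have step i : i != i0 -> ordS i != i0 -> signed_arc D (forward C i) (h i) (h (ordS i)).
    move=> ni nSi.
    have i0' := ps0 _ ni; have lt : (ps i).+1 < l.
      have := psl i; rewrite leq_eqVlt => /orP[/eqP e|//].
      case/negP: nSi; apply/eqP/ord_inj.
      rewrite [i]psE -[ordS _]/(iter (ps i).+1 (@ordS l) i0) iter_ordS e.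
      by rewrite modnDr modn_small.
    have e : ps (ordS i) = (ps i).+1 by apply: psI => //; rewrite {1}[i]psE.
    have := wpath_nth x (t := (ps i).-1) wp; rewrite size_mkseq /h e /=.
    have lt2 : (ps i).-1 < l - 2 by lia.
    move=> /(_ lt2); rewrite nth_mkseq // prednK // -psE.
    by case: (ps i) i0' => // m _.
  move=> i j ni nj Cij; have : C i j || C j i by rewrite Cij.
  case/(cycle_arc oC) => e.
    by have := step i ni; rewrite -e => /(_ nj); rewrite /forward -e Cij.
  have := step j nj; rewrite -e => /(_ ni); rewrite /forward -e.
  by case: oC => -[_ asym] _; rewrite (negbTE (asym _ _ Cij)).
Qed.

Definition tile X := [exists f : {ffun 'I_l -> T},
  [&& injectiveb f, [forall i, forall j, C i j ==> D (f i) (f j)] & X == f @: setT]].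

Lemma tileP X : reflect (exists2 f : {ffun 'I_l -> T}, is_copy C D f & X = f @: setT)
  (tile X).
Proof.
apply: (iffP existsP) => [[f /and3P[/injectiveP inj /forallP hom /eqP XE]]|[f [inj hom] XE]].
  by exists f => //; split=> // i j; apply/implyP; have /forallP := hom i; apply.
exists f; apply/and3P; split; [exact/injectiveP| |exact/eqP].
by apply/forallP => i; apply/forallP => j; apply/implyP/hom.
Qed.

Lemma tile_card X : tile X -> #|X| = l.
Proof. by case/tileP => f [inj _] ->; rewrite card_imset // cardsT card_ord. Qed.

(** Seen from [I], every boundary arc of [C] has the sign [b], and so has every pair formed by a
    value of [g] on [I] and one of [h] off [I]. Hence the two maps glue to a copy. Since [i0] lies
    in [I], the value of [h] there does not enter. *)
Lemma core_tile b I (g h : 'I_l -> T) (i0 : 'I_l) :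
  core C b I -> i0 \in I ->
  {in I &, injective g} -> (forall i j, i \in I -> j \in I -> C i j -> D (g i) (g j)) ->
  {in [set~ i0] &, injective h} ->
  (forall i j, i != i0 -> j != i0 -> C i j -> D (h i) (h j)) ->
  (forall i j, i \in I -> j \notin I -> signed_arc D b (g i) (h j)) ->
  (forall i j, i \in I -> j \notin I -> g i != h j) ->
  tile ([set g i | i in I] :|: [set h i | i in ~: I]).
Proof.
move=> cI i0I gi gD hi hD gh gnh; apply/tileP.
have I0 j : j \notin I -> j != i0 by apply: contraNneq => ->.
exists [ffun i => if i \in I then g i else h i]; first split.
- move=> i j; rewrite !ffunE; case: ifPn => iI; case: ifPn => jI.
  + exact: gi.
  + by move/eqP; rewrite (negbTE (gnh _ _ iI jI)).
  + by move/esym/eqP; rewrite (negbTE (gnh _ _ jI iI)).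
  + by apply: hi; rewrite !inE I0.
- move=> i j Cij; rewrite !ffunE; case: ifPn => iI; case: ifPn => jI.
  + exact: gD.
  + have : signed_arc C b i j by apply: cI => //; rewrite Cij.
    have := gh _ _ iI jI; case: (b) => //= _.
    by case: oC => -[_ asym] _; rewrite (negbTE (asym _ _ Cij)).
  + have : signed_arc C b j i by apply: cI => //; rewrite Cij orbT.
    have := gh _ _ jI iI; case: (b) => //= _.
    by case: oC => -[_ asym] _; rewrite (negbTE (asym _ _ Cij)).
  + by apply: hD; rewrite ?I0.
- rewrite -(setUCr I) imsetU; congr (_ :|: _); apply: eq_in_imset => i; rewrite ffunE.
    by move=> ->.
  by rewrite inE => /negbTE->.
Qed.

(** A source (for [b = true]) or a sink of the cycle is put at [x], the remaining path into [W]. The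
    set [P] is found before [x], so that one [P] serves all vertices joined to it. *)
Lemma star_tile b W : thr <= #|W| -> exists P, [/\ P \subset W, #|P| = l.-1
  & forall x, P \subset nbr D b x -> tile (x |: P)].
Proof.
move=> cW; have [i0 ci0] := core1 l3 oC nC b.
have [h [hi hW hD]] := cycle_minus_vertex i0 cW.
exists (h @: [set~ i0]); split.
- by apply/subsetP => y /imsetP[j]; rewrite !inE => nj ->; apply: hW.
- by rewrite card_in_imset // cardsC1 card_ord.
- move=> x /subsetP Px.
  have nx j : j != i0 -> signed_arc D b x (h j).
    by move=> nj; have := Px (h j); rewrite inE; apply; apply: imset_f; rewrite !inE.
  rewrite -[[set x]](imset_set1 (fun=> x) i0); apply: (core_tile (b := b)) hi hD _ _.
  - exact: ci0.
  - by rewrite inE.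
  - by move=> i j; rewrite !inE => /eqP-> /eqP->.
  - move=> i j; rewrite !inE => /eqP-> /eqP->.
    by case: oC => -[irr _] _; rewrite irr.
  - by move=> i j _; rewrite inE; apply: nx.
  - move=> i j _; rewrite inE => /nx axj; apply: contraTneq axj => ->.
    by rewrite arcxx.
Qed.

(** The two vertices given by [core2] are put at [x] and [v]; the arc from [x] to [v] serves in case
    they are adjacent on the cycle. *)
Lemma twin_tile b x v W : D x v -> thr <= #|W| ->
  W \subset nbr D b x :&: nbr D b v ->
  exists P, [/\ P \subset W, #|P| = l.-2 & tile ([set x; v] :|: P)].
Proof.
move=> xv cW /subsetP Wn; have [p [q [pq cpq]]] := core2 l3 oC nC b.
have [h [hi hW hD]] := cycle_minus_vertex p cW.
have npq j : j \notin [set p; q] -> j != p by rewrite !inE negb_or => /andP[].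
exists (h @: ~: [set p; q]); split.
- by apply/subsetP => y /imsetP[j]; rewrite inE => nj ->; apply/hW/npq.
- rewrite card_in_imset; last first.
    by move=> i j; rewrite !inE !negb_or => /andP[i1 _] /andP[j1 _]; apply: hi; rewrite !inE.
  have c2 : #|[set p; q]| = 2 by rewrite cards2 pq.
  have := cardsC [set p; q]; rewrite c2 card_ord.
  by move: #|~: _| => c; lia.
(* The tail of a possible arc between [p] and [q] has to go to [x]; the comparison with [C p q]
   selects it. *)
- pose g i := if (i == p) == C p q then x else v.
  have gE i j : i \in [set p; q] -> C i j -> j \in [set p; q] -> g i = x /\ g j = v.
    case: (oC) => -[irr asym] _ + Cij; rewrite !inE /g => /orP[] /eqP iE /orP[] /eqP jE;
      move: Cij; rewrite iE jE.
    + by rewrite irr.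
    + by move=> Cpq; rewrite Cpq !eqxx [q == p]eq_sym (negbTE pq).
    + by move=> Cqp; rewrite (negbTE (asym _ _ Cqp)) eqxx [q == p]eq_sym (negbTE pq).
    + by rewrite irr.
  have xv' : x != v by apply: contraTneq xv => ->; case: oD => -> .
  have gpq : [set g i | i in [set p; q]] = [set x; v].
    rewrite imsetU1 imset_set1 /g eqxx [q == p]eq_sym (negbTE pq).
    by case: (C p q) => //=; rewrite setUC.
  have gxv i : g i = x \/ g i = v by rewrite /g; case: ifP; [left|right].
  have ga i j : j \notin [set p; q] -> signed_arc D b (g i) (h j).
    move=> /npq/hW/Wn; rewrite !inE => /andP[ax av].
    by case: (gxv i) => ->.
  rewrite -gpq; apply: (core_tile (b := b)) hi hD _ _; rewrite ?inE ?eqxx //.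
  + move=> i j; rewrite !inE /g => /orP[] /eqP-> /orP[] /eqP-> //;
      rewrite eqxx [q == p]eq_sym (negbTE pq); case: (C p q) => //= e;
      by move: xv'; rewrite e eqxx.
  + by move=> i j iI jI Cij; have [-> ->] := gE i j iI Cij jI.
  + by move=> i j _; apply: ga.
  + move=> i j _ /(ga i) aij; apply: contraTneq aij => ->.
    by rewrite arcxx.
Qed.

End Embedding.

(** * Disjointness and cardinality of finite sets *)

Section SetHelpers.
Variable T : finType.
Implicit Types (A B X : {set T}).

Lemma disjointUl A B X : [disjoint A :|: B & X] = [disjoint A & X] && [disjoint B & X].
Proof. by rewrite -!setI_eq0 setIUl setU_eq0. Qed.

Lemma disjointUr A B X : [disjoint X & A :|: B] = [disjoint X & A] && [disjoint X & B].
Proof. by rewrite -!setI_eq0 setIUr setU_eq0. Qed.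

Lemma disjoint1r x A : [disjoint A & [set x]] = (x \notin A).
Proof. by rewrite disjoint_sym disjoints1. Qed.

Definition disjE := (disjointUl, disjointUr, disjoints1, disjoint1r, in_setU, in_set1, negb_or).

Lemma disjointW A B A' B' : A' \subset A -> B' \subset B -> [disjoint A & B] ->
  [disjoint A' & B'].
Proof. by move=> AA BB /(disjointWl AA)/(disjointWr BB). Qed.

Lemma leq_cardU A B a b : #|A| <= a -> #|B| <= b -> #|A :|: B| <= a + b.
Proof. by move=> Aa Bb; apply: leq_trans (leq_card_setU _ _) (leq_add Aa Bb). Qed.

Lemma subset_of_card A k : k <= #|A| -> exists2 B : {set T}, B \subset A & #|B| = k.
Proof.
move=> kA; exists [set:: take k (enum A)].
  by apply/subsetP => x; rewrite inE => /mem_take; rewrite mem_enum.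
by rewrite cardsE (card_uniqP _) ?take_uniq ?enum_uniq // size_takel // -cardE.
Qed.

Lemma card_setseq (s : seq T) : #|[set:: s]| <= size s.
Proof. by rewrite cardsE card_size. Qed.

Lemma uniq_card_setseq (s : seq T) : #|[set:: s]| = size s -> uniq s.
Proof. by rewrite cardsE => /card_uniqP. Qed.

End SetHelpers.

(** * Tilings, robust exchange of vertices, and absorbers *)

Section Tilings.
Variables (l : nat) (C : rel 'I_l).
Variables (T : finType) (D : rel T).
Implicit Types (A B F S W X P Q : {set T}).
Local Notation tile := (tile C D).

Definition tileable A := [exists P : {set {set T}},
  [&& trivIset P, cover P == A & [forall (X | X \in P), tile X]]].

Lemma tileableP A : reflect
  (exists P : {set {set T}}, [/\ trivIset P, cover P = A & forall X, X \in P -> tile X])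
  (tileable A).
Proof.
apply: (iffP existsP) => -[P].
  by case/and3P => tP /eqP cP /forall_inP aP; exists P.
by case=> tP cP aP; exists P; rewrite tP cP eqxx; apply/forall_inP.
Qed.

Lemma tileable0 : tileable set0.
Proof.
apply/tileableP; exists set0; split.
- by apply/trivIsetP => A B; rewrite inE.
- by rewrite /cover big_set0.
- by move=> X; rewrite inE.
Qed.

Lemma tile_tileable X : tile X -> tileable X.
Proof.
move=> tX; apply/tileableP; exists [set X]; split.
- by apply/trivIsetP => A B; rewrite !inE => /eqP-> /eqP->; rewrite eqxx.
- by rewrite /cover big_set1.
- by move=> Y; rewrite inE => /eqP->.
Qed.

Lemma tileableU A B : [disjoint A & B] -> tileable A -> tileable B -> tileable (A :|: B).
Proof.
move=> dAB /tileableP[P [tP cP aP]] /tileableP[P' [tP' cP' aP']].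
apply/tileableP; exists (P :|: P'); split.
- by apply: trivIsetU; rewrite ?cP ?cP'.
- by rewrite /cover bigcup_setU -/(cover P) -/(cover P') cP cP'.
- by move=> X; rewrite inE => /orP[/aP|/aP'].
Qed.

Lemma tileable_dvd A : tileable A -> l %| #|A|.
Proof.
move=> /tileableP[P [/eqP tP <- aP]]; rewrite -tP.
by apply: (big_ind (fun m => l %| m)) => [||X /aP/tile_card->] // x y; exact: dvdn_add.
Qed.

(** A tile may be the image of several maps; [pick] selects one of them, so that different members
    of [F] have different, hence disjoint, images. *)
Lemma tileable_factor : tileable [set: T] -> has_factor C D.
Proof.
move=> /tileableP[P [tP cP aP]].
pose good (f : {ffun 'I_l -> T}) X :=
  [&& injectiveb f, [forall i, forall j, C i j ==> D (f i) (f j)] & X == f @: setT].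
pose F := [set f : {ffun 'I_l -> T} |
  (f @: setT \in P) && ([pick g | good g (f @: setT)] == Some f)].
have codomE (f : {ffun 'I_l -> T}) : codom f =i f @: setT.
  by move=> x; apply/codomP/imsetP => [[i ->]|[i _ ->]]; [exists i|exists i].
exists F; split.
- move=> f; rewrite inE => /andP[_]; case: pickP => // g /and3P[/injectiveP inj hom _] /eqP[<-].
  by split=> // i j; apply/implyP; move/forallP: hom => /(_ i)/forallP; apply.
- move=> f g; rewrite !inE => /andP[fP /eqP fE] /andP[gP /eqP gE] fg.
  rewrite (eq_disjoint (codomE f)) (eq_disjoint_r (codomE g)).
  move/trivIsetP: tP; apply=> //; apply: contraNneq fg => e.
  by move: gE; rewrite -e fE => -[->].
- move=> v; have : v \in cover P by rewrite cP inE.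
  case/bigcupP => X XP vX; have /existsP[f0 gf0] := aP X XP.
  case: (pickP (good^~ X)) => [f gf|/(_ f0)]; last by rewrite /good gf0.
  have XE : X = f @: setT by case/and3P: (gf) => _ _ /eqP.
  have [g gE gX] : exists2 g, [pick g | good g X] = Some g & good g X.
    by case: pickP => [g gg|/(_ f)]; [exists g|rewrite gf].
  have XgE : X = g @: setT by case/and3P: (gX) => _ _ /eqP.
  exists g; last by rewrite codomE -XgE.
  by rewrite inE -XgE XP gE eqxx.
Qed.

(* A robust exchange of u and v: q bounds the forbidden sets, K the gadgets. *)
Definition reach (q K : nat) u v := [forall F : {set T}, (#|F| <= q) ==>
  [exists S : {set T}, [&& [disjoint S & F], u \notin S, v \notin S, #|S| <= K,
                 tileable (u |: S) & tileable (v |: S)]]].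

Lemma reachP q K u v : reflect
  (forall F, #|F| <= q -> exists S, [/\ [disjoint S & F], u \notin S /\ v \notin S,
     #|S| <= K, tileable (u |: S) & tileable (v |: S)])
  (reach q K u v).
Proof.
apply: (iffP forallP) => H F; last first.
  apply/implyP => /H[S [dS [uS vS] cS tu tv]]; apply/existsP; exists S.
  by rewrite dS uS vS cS tu tv.
move=> cF; have /implyP/(_ cF)/existsP[S /and5P[dS uS vS cS /andP[tu tv]]] := H F.
by exists S.
Qed.

Lemma reach_sym q K u v : reach q K u v = reach q K v u.
Proof.
by apply/reachP/reachP => H F /H[S [dS [uS vS] cS tu tv]]; exists S.
Qed.

Lemma reach_mono q K q' K' u v : q' <= q -> K <= K' -> reach q K u v -> reach q' K' u v.
Proof.
move=> qq KK /reachP H; apply/reachP => F cF.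
have [S [dS [uS vS] cS tu tv]] := H F (leq_trans cF qq).
by exists S; split=> //; apply: leq_trans KK.
Qed.

(** An intermediate [w] is picked outside [F], [u] and [v], which explains the summand 2. In the
    union of the two gadgets with [w], the vertex [w] completes the gadget that the added vertex
    does not. *)
Lemma reach_trans q K q' K' u v :
  q' + 2 < #|[set w | reach q K u w && reach q K w v]| ->
  q' + K + 1 <= q -> 2 * K + 1 <= K' -> reach q' K' u v.
Proof.
move=> cw qq KK; apply/reachP => F cF.
have [w] : exists w, w \in [set w | reach q K u w && reach q K w v] :\: (F :|: [set u; v]).
  apply/set0Pn; rewrite -card_gt0; move: cw; set A := finset _.
  have := cardsID (F :|: [set u; v]) A.
  have := subset_leq_card (subsetIr A (F :|: [set u; v])).
  have : #|F :|: [set u; v]| <= q' + 2.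
    by apply: leq_cardU => //; rewrite cards2; case: (_ != _).
  by lia.
rewrite !inE !negb_or => /andP[/and3P[wF wu wv] /andP[/reachP Hu /reachP Hv]].
have [|S1 [dS1 [uS1 wS1] cS1 tu tw1]] := Hu (F :|: [set v]).
  by apply: leq_trans (leq_cardU cF (leqnn _)) _; rewrite cards1; lia.
have [|S2 [dS2 [wS2 vS2] cS2 tw2 tv]] := Hv (F :|: S1 :|: [set u]).
  apply: leq_trans (leq_cardU (leq_cardU cF cS1) (leqnn _)) _; rewrite cards1; lia.
move: dS1 dS2; rewrite !disjE => /andP[dS1 vS1] /andP[/andP[dS2 dS21] uS2].
exists (w |: (S1 :|: S2)); split.
- by rewrite !disjE wF dS1 dS2.
- by rewrite !disjE [u == w]eq_sym [v == w]eq_sym wu wv uS1 uS2 vS1 vS2.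
- have c1 : #|[set w]| <= 1 by rewrite cards1.
  by apply: leq_trans (leq_cardU c1 (leq_cardU cS1 cS2)) _; move: KK; clear; lia.
- have -> : u |: (w |: (S1 :|: S2)) = (u |: S1) :|: (w |: S2).
    by apply/setP => z; rewrite !in_setU; do !case: (_ \in _).
  apply: tileableU => //.
  by rewrite !disjE [u == w]eq_sym wu uS2 wS1 disjoint_sym dS21.
- have -> : v |: (w |: (S1 :|: S2)) = (w |: S1) :|: (v |: S2).
    by apply/setP => z; rewrite !in_setU; do !case: (_ \in _).
  apply: tileableU => //.
  by rewrite !disjE wv wS2 vS1 disjoint_sym dS21.
Qed.

(** The gadgets are found one after the other, each avoiding both lists and all earlier gadgets. The
    two lists themselves may overlap. *)
Lemma reach_seq q K (s : seq (T * T)) F :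
  all (fun p => reach q K p.1 p.2) s -> uniq (unzip1 s) -> uniq (unzip2 s) ->
  #|F| + 2 * size s + size s * K <= q ->
  exists S, [/\ [disjoint S & F :|: [set:: unzip1 s] :|: [set:: unzip2 s]],
    #|S| <= size s * K, tileable ([set:: unzip1 s] :|: S) & tileable ([set:: unzip2 s] :|: S)].
Proof.
elim: s F => [|[x y] s IH] F /=.
  move=> _ _ _ _; exists set0; rewrite !set_nil !set0U cards0; split=> //.
  - by rewrite -setI_eq0 set0I.
  - exact: tileable0.
  - exact: tileable0.
case/andP => /reachP rxy rs /andP[xs us1] /andP[ys us2] cF.
rewrite !set_cons; set X := [set:: unzip1 s]; set Y := [set:: unzip2 s].
have cX : #|X| <= size s by rewrite -(size_map fst s) card_setseq.
have cY : #|Y| <= size s by rewrite -(size_map snd s) card_setseq.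
have xX : x \notin X by rewrite inE.
have yY : y \notin Y by rewrite inE.
have [|S1 [dS1 [xS1 yS1] cS1 tx ty]] := rxy (F :|: X :|: Y).
  by apply: leq_trans (leq_cardU (leq_cardU (leqnn _) cX) cY) _; move: cF; clear; lia.
have [|S2 [dS2 cS2 tX tY]] := IH (F :|: S1 :|: [set x; y]) rs us1 us2.
  have c2 : #|[set x; y]| <= 2 by rewrite cards2; case: (_ != _).
  have := leq_cardU (leq_cardU (leqnn #|F|) cS1) c2; move: cF; clear; lia.
move: dS1 dS2; rewrite -/X -/Y !disjE.
case/andP=> /andP[dS1F dS1X] dS1Y /andP[/andP[/andP[/andP[dS2F dS21] /andP[xS2 yS2]] dS2X] dS2Y].
exists (S1 :|: S2); split.
- by rewrite !disjE dS1F dS1X dS1Y dS2F xS1 yS1 xS2 yS2 dS2X dS2Y.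
- by apply: leq_trans (leq_cardU cS1 cS2) _; clear; lia.
- rewrite setUACA; apply: tileableU => //.
  by rewrite !disjE xX xS2 dS1X disjoint_sym dS21.
- rewrite setUACA; apply: tileableU => //.
  by rewrite !disjE yY yS2 dS1Y disjoint_sym dS21.
Qed.

Lemma tile_uniq (s : seq T) : tile [set:: s] -> size s = l -> uniq s.
Proof. by move=> /tile_card cs ss; apply: uniq_card_setseq; rewrite cs ss. Qed.

(* If two tiles A and B agree up to reachability except that A has one more
   element reachable from u and B one more element reachable from w, then
   completing the tile A or the tile B exchanges u with w. *)
Lemma reach_exchange q K q' u w :
  (forall F, #|F| <= q' + 2 -> exists a b (s : seq (T * T)),
    [/\ tile [set:: a :: unzip1 s] /\ tile [set:: b :: unzip2 s],
        [disjoint [set:: a :: unzip1 s] & [set:: b :: unzip2 s]],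
        [disjoint F & [set:: a :: unzip1 s] :|: [set:: b :: unzip2 s]],
        all (fun p => reach q K p.1 p.2) s /\ size s = l.-1
      & reach q K u a /\ reach q K w b]) ->
  0 < l -> q' + 2 * l.+1 + l.+1 * K <= q ->
  reach q' (l.+1 * K + 2 * l) u w.
Proof.
move=> H l0 qq; apply/reachP => F cF.
have [|a [b [s [[tA tB] dAB dF [rs ss] [rua rwb]]]]] := H (F :|: [set u; w]).
  by apply: leq_cardU => //; rewrite cards2; case: (_ != _).
(* The two lists of [L] are [u |: B] and [w |: A], so the gadget [S0] completes either of them. In
   [S0 :|: A :|: B], adding [u] leaves the tile [A] over, and adding [w] leaves the tile [B]. *)
pose L := (u, a) :: (b, w) :: [seq (p.2, p.1) | p <- s].
have L1E : unzip1 L = u :: b :: unzip2 s by rewrite /L /unzip1 /unzip2 /= -map_comp.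
have L2E : unzip2 L = a :: w :: unzip1 s by rewrite /L /unzip1 /unzip2 /= -map_comp.
have sL : size L = l.+1 by rewrite /L /= size_map ss; move: l0; clear; lia.
have uA : uniq (a :: unzip1 s) by apply: tile_uniq; rewrite //= size_map ss prednK.
have uB : uniq (b :: unzip2 s) by apply: tile_uniq; rewrite //= size_map ss prednK.
set A := [set:: a :: unzip1 s] in tA dAB dF; set B := [set:: b :: unzip2 s] in tB dAB dF.
have cA : #|A| = l by exact: tile_card tA.
have cB : #|B| = l by exact: tile_card tB.
move: dF; rewrite !disjE => /andP[/andP[dFA dFB] /andP[/andP[uA' uB'] /andP[wA' wB']]].
have [||||S0 [dS0 cS0 t1 t2]] := @reach_seq q K L F.
- rewrite /L /= rua reach_sym rwb /= all_map; apply: sub_all rs => p /=.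
  by rewrite reach_sym.
- by rewrite L1E cons_uniq uB andbT; move: uB'; rewrite inE.
- move: uA wA'; rewrite L2E inE /= !inE !negb_or [w == a]eq_sym.
  by case/andP=> -> -> /andP[-> ->].
- by rewrite sL; move: cF l0 qq; clear; lia.
move: dS0 cS0 t1 t2; rewrite L1E L2E.
have -> : [set:: u :: b :: unzip2 s] = u |: B by rewrite set_cons.
have -> : [set:: a :: w :: unzip1 s] = w |: A by rewrite /A !set_cons setUCA.
rewrite sL !disjE => /andP[/andP[dS0F /andP[uS0 dS0B]] /andP[wS0 dS0A]] cS0 t1 t2.
exists (S0 :|: A :|: B); split.
- by rewrite !disjE dS0F [ [disjoint A & F] ]disjoint_sym dFA [ [disjoint B & F] ]disjoint_sym dFB.
- by rewrite !disjE uS0 uA' uB' wS0 wA' wB'.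
- by apply: leq_trans (leq_cardU (leq_cardU cS0 (leqnn _)) (leqnn _)) _; rewrite cA cB; clear; lia.
- have -> : u |: (S0 :|: A :|: B) = (u |: B :|: S0) :|: A.
    by apply/setP => z; rewrite !in_setU; do !case: (_ \in _).
  apply: tileableU (tile_tileable tA) => //.
  by rewrite !disjE uA' dS0A disjoint_sym dAB.
- have -> : w |: (S0 :|: A :|: B) = (w |: A :|: S0) :|: B.
    by apply/setP => z; rewrite !in_setU; do !case: (_ \in _).
  apply: tileableU (tile_tileable tB) => //.
  by rewrite !disjE wB' dS0B dAB.
Qed.

(** The second entries form a tile [X]. Without the first entries the gadgets are completed by [X];
    with them they are completed by the first entries, and [X] is a tile of its own. *)
Lemma absorber q K F (s : seq (T * T)) :
  all (fun p => reach q K p.1 p.2) s -> size s = l -> uniq (unzip1 s) ->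
  tile [set:: unzip2 s] -> [disjoint [set:: unzip2 s] & F :|: [set:: unzip1 s]] ->
  #|F| + 2 * l + l * K <= q ->
  exists S, [/\ [disjoint S & F :|: [set:: unzip1 s]], #|S| <= l * K + l,
    tileable S & tileable ([set:: unzip1 s] :|: S)].
Proof.
move=> rs ss us tX; have cX := tile_card tX.
have us2 : uniq (unzip2 s) by apply: tile_uniq; rewrite ?size_map.
move: tX cX; set X := [set:: unzip2 s]; set Q := [set:: unzip1 s] => tX cX.
rewrite !disjE => /andP[dXF dXQ] cF.
have [|S0 []] := @reach_seq q K s F rs us us2; first by rewrite ss.
rewrite -/X -/Q ss !disjE => /andP[/andP[dS0F dS0Q] dS0X] cS0 tQ tX'.
exists (S0 :|: X); split.
- by rewrite !disjE dS0F dS0Q dXF dXQ.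
- by apply: leq_trans (leq_cardU cS0 (leqnn _)) _; rewrite cX.
- by rewrite setUC.
- rewrite setUA; apply: tileableU (tile_tileable tX) => //.
  by rewrite !disjE disjoint_sym dXQ.
Qed.

Hypotheses (l3 : 3 <= l) (oC : cycle_orientation C) (nC : ~ consistently_directed C).
Hypothesis oD : oriented_graph D.

(** A suitable path in the common neighbourhood, outside [F], extends to a copy by [u] as well as by
    [v], so it is a gadget with [l.-1] vertices. *)
Lemma reach_common b u v q : path_threshold l D + q <= #|nbr D b u :&: nbr D b v| ->
  reach q l.-1 u v.
Proof.
move=> cuv; apply/reachP => F cF.
have cW : path_threshold l D <= #|(nbr D b u :&: nbr D b v) :\: F|.
  have := cardsID F (nbr D b u :&: nbr D b v).
  have := subset_leq_card (subsetIr (nbr D b u :&: nbr D b v) F); lia.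
have [P [/subsetP PW cP tP]] := star_tile l3 oC nC oD b cW.
have Pu : P \subset nbr D b u by apply/subsetP => z /PW; rewrite !inE => /and3P[].
have Pv : P \subset nbr D b v by apply/subsetP => z /PW; rewrite !inE => /and3P[].
exists P; split.
- by rewrite disjoint_subset; apply/subsetP => z /PW; rewrite !inE => /andP[].
- by split; [move: Pu|move: Pv] => /subsetP PN; apply/negP => /PN; rewrite inE arcxx.
- by rewrite cP.
- exact/tile_tileable/tP.
- exact/tile_tileable/tP.
Qed.

End Tilings.

(** * Arc densities and degrees *)

Section Degrees.
Variables (T : finType) (D : rel T).
Hypothesis oD : oriented_graph D.
Implicit Types (A B F P X Y : {set T}) (b : bool) (x y z : T).
Local Notation nbr := (nbr D).
Local Notation nbrs := (nbrs D).
Variable n : nat.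
Hypothesis nT : #|T| = n.

Definition arcs A B := \sum_(x in A) #|nbrs x :&: B|.

Lemma card_setI_sum (p : pred T) B : #|[set y | p y] :&: B| = \sum_(y in B) p y.
Proof.
rewrite -sum1_card big_mkcond [RHS]big_mkcond; apply: eq_bigr => y _.
by rewrite !inE; case: (p y); case: (y \in B).
Qed.

Lemma arcsC A B : arcs A B = arcs B A.
Proof.
rewrite /arcs; under eq_bigr => x _ do rewrite card_setI_sum.
rewrite exchange_big; apply: eq_bigr => y _; rewrite card_setI_sum.
by apply: eq_bigr => x _; rewrite underlyingC.
Qed.

Lemma arcsUr A B B' : arcs A (B :|: B') <= arcs A B + arcs A B'.
Proof.
rewrite -big_split leq_sum // => x _; rewrite setIUr; exact: leq_card_setU.
Qed.

Lemma arcsUl A B B' : arcs (B :|: B') A <= arcs B A + arcs B' A.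
Proof. by rewrite ![arcs _ A]arcsC arcsUr. Qed.

Lemma arcs_card A B : arcs A B <= #|A| * #|B|.
Proof. by rewrite -sum_nat_const leq_sum // => x _; rewrite subset_leq_card ?subsetIr. Qed.

Lemma arcsS A B A' B' : A \subset A' -> B \subset B' -> arcs A B <= arcs A' B'.
Proof.
move=> /subsetP AA BB; rewrite /arcs big_mkcond [X in _ <= X]big_mkcond leq_sum // => x _.
case: ifP => // /AA ->; by rewrite subset_leq_card // setIS.
Qed.

Lemma cardsID_le A B : #|A| <= #|A :\: B| + #|B|.
Proof. by rewrite -(cardsID B A) addnC leq_add2l subset_leq_card ?subsetIr. Qed.

Lemma nbrs_card x B : #|nbrs x :&: B| <= #|nbr true x :&: B| + #|nbr false x :&: B|.
Proof. by rewrite nbrsE setIUl leq_card_setU. Qed.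

(** Removing [F] on both sides costs at most [2 * #|F| * n] arcs. If every remaining vertex had
    fewer than [t] neighbours of each sign, at most [2 * t * n] further arcs would be left. *)
Lemma dense_star (c t : nat) A B F : n * n <= c * arcs A B -> c * (2 * #|F| + 2 * t) < n ->
  exists x b, x \in A :\: F /\ t <= #|nbr b x :&: (B :\: F)|.
Proof.
move=> dAB cF.
have [/exists_inP[x xA /existsP[b tb]]|] :=
    boolP [exists x in A :\: F, exists b, t <= #|nbr b x :&: (B :\: F)|]; first by exists x, b.
rewrite negb_exists_in => /forall_inP no; exfalso.
have hi : arcs A B <= n * (2 * #|F| + 2 * t).
  apply: (@leq_trans (arcs (A :\: F) (B :\: F) + arcs (A :\: F) F + arcs F B)).
    have AE : A \subset (A :\: F) :|: F.
      by apply/subsetP => z; rewrite !inE => ->; rewrite andbT orNb.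
    have BE : B \subset (B :\: F) :|: F.
      by apply/subsetP => z; rewrite !inE => ->; rewrite andbT orNb.
    apply: leq_trans (arcsS AE (subxx B)) _; apply: leq_trans (arcsUl _ _ _) _.
    by rewrite leq_add2r; apply: leq_trans (arcsS (subxx _) BE) (arcsUr _ _ _).
  have h1 : arcs (A :\: F) (B :\: F) <= n * (2 * t).
    apply: leq_trans (_ : \sum_(x in A :\: F) 2 * t <= _).
      apply: leq_sum => x /no; rewrite negb_exists => /forallP nb.
      apply: leq_trans (nbrs_card _ _) _.
      by have := nb true; have := nb false; rewrite -!ltnNge; lia.
    by rewrite sum_nat_const leq_mul2r -nT max_card orbT.
  have h2 : arcs (A :\: F) F <= n * #|F|.
    by apply: leq_trans (arcs_card _ _) _; rewrite leq_mul2r -nT max_card orbT.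
  have h3 : arcs F B <= n * #|F|.
    by apply: leq_trans (arcs_card _ _) _; rewrite mulnC leq_mul2r -nT max_card orbT.
  by apply: leq_trans (leq_add (leq_add h1 h2) h3) _; rewrite -!mulnDr leq_mul2l; lia.
have n0 : 0 < n by lia.
have : n * n < n * n.
  apply: leq_ltn_trans dAB _; apply: leq_ltn_trans (leq_mul (leqnn c) hi) _.
  by rewrite mulnCA ltn_pmul2l.
by rewrite ltnn.
Qed.

Lemma dense_edge A : independence_number (underlying D) < #|A| ->
  exists x v, [/\ x \in A, v \in A & D x v].
Proof.
move=> cA; have [/existsP[x /existsP[v /and3P[xA vA xv]]]|no] :=
  boolP [exists x, exists v, [&& x \in A, v \in A & D x v]]; first by exists x, v.
suff /independent_card : independent (underlying D) A by rewrite leqNgt cA.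
have key x v : x \in A -> v \in A -> ~~ D x v.
  move=> xA vA; apply: contra no => xv; apply/existsP; exists x.
  by apply/existsP; exists v; rewrite xA vA.
apply/forall_inP => x xA; apply/forall_inP => v vA.
by rewrite /underlying /= negb_or !key.
Qed.

(** Of the two ordered pairs on two vertices at most one is an arc of the given sign. *)
Lemma arc_sum b A : 2 * (\sum_(x in A) #|nbr b x :&: A|) <= #|A| * #|A|.
Proof.
under eq_bigr => x _ do rewrite card_setI_sum.
rewrite mul2n -addnn {2}exchange_big -big_split -sum_nat_const leq_sum //= => x xA.
rewrite -big_split -sum1_card leq_sum //= => y _.
have := @arc_asym _ _ oD b x y.
by case: (signed_arc D b x y) => [/(_ isT)/negbTE->|_] //; case: (signed_arc _ _ _ _).
Qed.

(* The arcs inside A are counted once, so A spans at most half of the pairs. *)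
Lemma high_degree_card (k s : nat) b P A : A \subset P -> A != set0 ->
  (forall x, x \in A -> s <= k * #|nbr b x :&: P|) -> k * #|A| + 2 * s <= 2 * k * #|P|.
Proof.
move=> AP; rewrite -card_gt0 => A0 hi.
have PE x : #|nbr b x :&: P| <= #|nbr b x :&: A| + (#|P| - #|A|).
  rewrite -(cardsID A (nbr b x :&: P)) leq_add ?subset_leq_card //.
    by rewrite setSI // subsetIl.
  by rewrite -cardsDS // subset_leq_card // setSD // subsetIr.
have cAP := subset_leq_card AP.
have : #|A| * s <= k * (\sum_(x in A) #|nbr b x :&: A| + #|A| * (#|P| - #|A|)).
  rewrite -[#|A| * s]sum_nat_const -[#|A| * (_ - _)]sum_nat_const -big_split big_distrr leq_sum //=.
  by move=> x /hi h; apply: leq_trans h _; rewrite leq_mul2l PE orbT.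
have := arc_sum b A; move: (\sum_(x in A) _) => S.
move: #|A| #|P| A0 cAP => a p a0 ap S2 aS.
have : a * (2 * s) <= a * (k * (a + 2 * (p - a))).
  have -> : a * (2 * s) = 2 * (a * s) by nia.
  have -> : a * (k * (a + 2 * (p - a))) = k * (a * a) + 2 * (k * (a * (p - a))) by nia.
  by have := leq_mul (leqnn k) S2; nia.
rewrite leq_pmul2l // => h.
have -> : 2 * k * p = k * a + k * (a + 2 * (p - a)) by nia.
by rewrite leq_add2l.
Qed.

(** * Consequences of the Ore condition, in integer form with [1/m] in place of the real slack *)

Variable m : nat.
Hypotheses (m2 : 2 <= m) (mn : m < n).
Hypothesis ore : forall x y, x != y -> ~~ underlying D x y ->
  (3 * m + 4) * n <= 4 * m * (stardeg D x + stardeg D y).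

Lemma stardegE x : stardeg D x = maxn #|nbr true x| #|nbr false x|.
Proof. by []. Qed.

Lemma stardeg_attained x : exists b, stardeg D x = #|nbr b x|.
Proof.
by rewrite stardegE /maxn; case: ifP => _; [exists false|exists true].
Qed.

Lemma nbr_stardeg b x : #|nbr b x| <= stardeg D x.
Proof. by rewrite stardegE leq_max; case: b; rewrite leqnn ?orbT. Qed.

Definition low P :=
  [set x in P | [forall b : bool, 4 * m * #|nbr b x :&: P| < (3 * m + 2) * #|P|]].

(* The source of the constant 3/4: inside any P, a positive proportion of the
   vertices has both degrees below about 3/4 of #|P|. *)
Lemma low_card P : 2 * #|P| <= m * #|low P|.
Proof.
pose hi b := [set x in P | (3 * m + 2) * #|P| <= 4 * m * #|nbr b x :&: P|].
(* Each sign has at most (1/2 - 1/m) [#|P|] vertices of high degree, so the two signs together leave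
   a proportion 2/m of [P]. *)
have hic b : 4 * m * #|hi b| <= (2 * m - 4) * #|P|.
  have [->|hi0] := eqVneq (hi b) set0; first by rewrite cards0 muln0.
  have hiP : hi b \subset P by apply/subsetP => x; rewrite inE => /andP[].
  have h : 4 * m * #|hi b| + 2 * ((3 * m + 2) * #|P|) <= 2 * (4 * m) * #|P|.
    by apply: (high_degree_card (b := b)) hiP hi0 _ => x; rewrite inE => /andP[].
  rewrite mulnBl; move: h; rewrite !mulnDl; lia.
have : #|P| <= #|low P| + (#|hi true| + #|hi false|).
  apply: leq_trans (_ : #|low P :|: (hi true :|: hi false)| <= _).
    apply: subset_leq_card; apply/subsetP => x xP; rewrite !inE xP /=.
    rewrite -implyNb negb_forall; apply/implyP => /existsP[[]].
      by rewrite -leqNgt => ->.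
    by rewrite -leqNgt => ->; rewrite orbT.
  by apply: leq_trans (leq_card_setU _ _) _; rewrite leq_add2l leq_card_setU.
move: (hic true) (hic false); rewrite mulnBl; move: #|P| #|low P| #|hi true| #|hi false|.
move=> p q h1 h2 H1 H2 H3; have := leq_mul (leqnn m) H3; nia.
Qed.

(** If the star degree of [v] were below [n / (2 * m)], the closed neighbourhood of [v] would be too
    small to contain all low vertices. A low vertex [y] not adjacent to [v] has star degree below
    (3/4 + 1/(2m)) [n], and the pair violates the Ore condition. *)
Lemma stardeg_lower v : n <= 2 * m * stardeg D v.
Proof.
rewrite leqNgt; apply/negP => lt.
have := low_card [set: T]; rewrite cardsT nT => lc.
have nv : #|nbrs v| <= 2 * stardeg D v.
  have := nbrs_card v [set: T]; rewrite !setIT => h; apply: leq_trans h _.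
  by have := nbr_stardeg true v; have := nbr_stardeg false v; lia.
have [y] : exists y, y \in low [set: T] :\: (v |: nbrs v).
  apply/set0Pn; rewrite -card_gt0.
  have := cardsID_le (low [set: T]) (v |: nbrs v).
  have : #|v |: nbrs v| <= 1 + #|nbrs v| by rewrite cardsU1; case: (_ \notin _).
  move: nv lc lt mn; move: #|_ :\: _| #|_ |: _| #|low _| #|nbrs v| (stardeg D v).
  clear; move=> a b c d e H1 H2 H3 H4 H5 H6.
  rewrite lt0n; apply/negP => /eqP a0; subst a.
  have := leq_mul (leqnn m) H6; have := leq_mul (leqnn m) H5; have := leq_mul (leqnn m) H1.
  nia.
rewrite !inE !negb_or => /andP[/andP[yv nvy] /forallP ly].
have [b bE] := stardeg_attained y.
have := ly b; rewrite setIT cardsT nT -bE.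
have := @ore v y; rewrite eq_sym yv /underlying /= negb_or nvy => /(_ isT isT).
by move: lt; clear; rewrite !mulnDr !mulnDl; lia.
Qed.

(** With few arcs across, many low vertices of either side have fewer than [n / (8 * m)] neighbours
    on the other side. For one such vertex on each side the star degrees sum to less than (3/4 +
    1/m) [n], so all these pairs are adjacent, and they are numerous. *)
Lemma arcs_across (c : nat) P : n <= c * #|P| -> n <= c * #|~: P| ->
  n * n <= 8 * m * m * c * c * arcs P (~: P).
Proof.
move=> cP cQ; set E := arcs _ _.
pose lo X := [set x in low X | 8 * m * #|nbrs x :&: ~: X| < n].
have c0 : 0 < c by move: cP; case: (c) => //; lia.
have [small|big] := leqP (8 * m * m * c * E) (n * n); last first.
  by apply: leq_trans (ltnW big) _; rewrite leq_mul2r leq_pmulr ?orbT.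
have n0 : 0 < n by lia.
have loc X : n <= c * #|X| -> arcs X (~: X) = E -> #|X| <= m * #|lo X|.
  move=> cX XE; pose hi := [set x in X | n <= 8 * m * #|nbrs x :&: ~: X|].
  have h1 : #|hi| * n <= 8 * m * E.
    rewrite -XE /arcs big_distrr -sum_nat_const /=.
    rewrite big_mkcond [X in _ <= X]big_mkcond leq_sum //= => x _; rewrite inE.
    by case: (x \in X) => //=; case: ifP.
  have h2 : #|low X| <= #|lo X| + #|hi|.
    apply: leq_trans (leq_card_setU _ _); apply: subset_leq_card; apply/subsetP => x xl.
    have xX : x \in X by move: xl; rewrite inE => /andP[].
    by rewrite in_setU [x \in lo X]inE xl [x \in hi]inE xX /= orbC leqNgt orNb.
  have := low_card X; move: cX h1 h2 small.
  move: #|X| #|lo X| #|hi| #|low X| => x a h lw cX h1 h2 small lX.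
  have h3 : m * h <= x.
    rewrite -(leq_pmul2r n0) -(leq_pmul2r c0).
    apply: leq_trans (_ : 8 * m * m * c * E <= _).
      by have := leq_mul (leqnn (m * c)) h1; clear; lia.
    by apply: leq_trans small _; have := leq_mul cX (leqnn n); clear; lia.
  by have := leq_mul (leqnn m) h2; rewrite mulnDr; move: h3 lX; clear; lia.
have pairs x y : x \in lo P -> y \in lo (~: P) -> underlying D x y.
  rewrite !inE => /andP[/andP[xP /forallP lx] hx] /andP[/andP[yP /forallP ly] hy].
  have xy : x != y by apply: contraNneq yP => <-.
  rewrite setCK in hy; apply: contraT => /(ore xy).
  have [bx bxE] := stardeg_attained x; have [b' b'E] := stardeg_attained y.
  have hX z b X : #|nbr b z| <= #|nbr b z :&: X| + #|nbrs z :&: ~: X|.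
    rewrite -(cardsID X (nbr b z)) leq_add2l subset_leq_card // setDE setSI //.
    exact: nbr_sub.
  move: (lx bx) (ly b') (hX x bx P) (hX y b' (~: P)); rewrite setCK.
  rewrite bxE b'E; move: (cardsC P) hx hy; rewrite nT.
  move: #|nbrs x :&: _| #|nbrs y :&: _| #|nbr bx x| #|nbr b' y| #|nbr bx x :&: _| #|nbr b' y :&: _|.
  move: #|P| #|~: P|; clear => p q a b c d e f.
  move=> <- H1 H2 H3 H4 H5 H6 H7.
  have := leq_mul (leqnn (4 * m)) H5; have := leq_mul (leqnn (4 * m)) H6.
  by move: H1 H2 H3 H4 H7; clear; lia.
have h1 := loc _ cP (erefl _); have h2 := loc _ cQ.
rewrite setCK arcsC in h2; have {}h2 := h2 (erefl _).
have : #|lo P| * #|lo (~: P)| <= E.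
  apply: leq_trans (_ : arcs (lo P) (lo (~: P)) <= _).
    rewrite /arcs -sum_nat_const leq_sum // => x xP.
    by rewrite subset_leq_card // subsetI subxx andbT; apply/subsetP => y yP; rewrite inE pairs.
  by apply: arcsS; apply/subsetP => x; rewrite !inE => /andP[/andP[]].
move: h1 h2 cP cQ; move: #|P| #|~: P| #|lo P| #|lo (~: P)| => p q a b h1 h2 cP cQ ab.
apply: leq_trans (leq_mul cP cQ) _.
apply: leq_trans (leq_mul (leq_mul (leqnn c) h1) (leq_mul (leqnn c) h2)) _.
apply: leq_trans (_ : 1 * m * m * c * c * (a * b) <= _); first by clear; lia.
by rewrite !leq_mul.
Qed.

Lemma low_stardeg_adjacent x y : x != y -> 8 * m * stardeg D x < (3 * m + 4) * n ->
  8 * m * stardeg D y < (3 * m + 4) * n -> underlying D x y.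
Proof.
move=> xy hx hy; apply: contraT => /(ore xy); move: hx hy; clear; nia.
Qed.

Definition wide X Y b := [set x in X | 3 * n <= 8 * #|nbr b x :&: Y|].

(** Sparsity of [X] leaves few vertices with many neighbours in [X]. Vertices of star degree below
    (3/8 + 1/(2m)) [n] are pairwise adjacent, so few of them have few neighbours in [X]. Every other
    vertex of [X] loses at most [n / (16 * m)] neighbours to [X] and as many to the rest, and keeps
    3/8 [n] in [Y]. *)
Lemma wide_card (c k : nat) X Y : n <= c * #|X| -> 16 * m * #|~: (X :|: Y)| <= n ->
  16 * m <= k -> 8 * c <= k -> 4 * c * k * arcs X X <= n * n -> 8 * c <= n ->
  n <= 2 * c * (#|wide X Y true| + #|wide X Y false|).
Proof.
move=> cX cR km kc cXX cn.
have n0 : 0 < n by lia.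
have c0 : 0 < c by move: cX; case: (c) => //; lia.
pose hi := [set x in X | n <= k * #|nbrs x :&: X|].
pose lo := [set x in X | (k * #|nbrs x :&: X| < n) && (8 * m * stardeg D x < (3 * m + 4) * n)].
have h1 : 4 * c * #|hi| <= n.
  rewrite -(leq_pmul2r n0); apply: leq_trans cXX; rewrite -mulnA -[4 * c * k * _]mulnA leq_mul2l.
  apply/orP; right; rewrite /arcs big_distrr -sum_nat_const /=.
  rewrite big_mkcond [X in _ <= X]big_mkcond leq_sum //= => x _; rewrite inE.
  by case: (x \in X) => //=; case: ifP.
have h2 : 4 * c * #|lo| <= n.
  have [->|/set0Pn[x xl]] := eqVneq lo set0; first by rewrite cards0 muln0.
  have [xX kx dx] : [/\ x \in X, k * #|nbrs x :&: X| < n & 8 * m * stardeg D x < (3 * m + 4) * n].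
    by move: xl; rewrite inE => /andP[-> /andP[]].
  have : #|lo| <= 1 + #|nbrs x :&: X|.
    apply: leq_trans (_ : #|x |: (nbrs x :&: X)| <= _); last by rewrite cardsU1; case: (_ \notin _).
    apply: subset_leq_card; apply/subsetP => y; rewrite !inE => /andP[yX /andP[_ dy]].
    by have [//|yx] := eqVneq y x; rewrite yX andbT low_stardeg_adjacent // eq_sym.
  move=> h; have := leq_mul (leqnn (8 * c)) h; have := leq_mul kc (leqnn #|nbrs x :&: X|).
  move: kx cn; rewrite !mulnDr muln1; lia.
have h3 : #|X| <= #|hi| + #|lo| + (#|wide X Y true| + #|wide X Y false|).
  apply: leq_trans (_ : #|hi :|: lo :|: (wide X Y true :|: wide X Y false)| <= _); last first.
    by apply: leq_trans (leq_card_setU _ _) _; rewrite leq_add ?leq_card_setU.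
  apply: subset_leq_card; apply/subsetP => x xX; rewrite !inE xX /=.
  have [//|kx] := leqP n (k * #|nbrs x :&: X|).
  have [//|dx] := ltnP (8 * m * stardeg D x) ((3 * m + 4) * n).
  have [b bE] := stardeg_attained x.
  suff w : 3 * n <= 8 * #|nbr b x :&: Y| by case: (b) w => ->; rewrite ?orbT.
  have : #|nbr b x| <= #|nbr b x :&: Y| + #|nbrs x :&: X| + #|~: (X :|: Y)|.
    apply: leq_trans (_ : #|(nbr b x :&: Y) :|: (nbrs x :&: X) :|: ~: (X :|: Y)| <= _).
      apply: subset_leq_card; apply/subsetP => y yb.
      have yn := subsetP (nbr_sub D b x) _ yb.
      by rewrite !in_setU !in_setI in_setC in_setU yb yn /=; case: (y \in X); case: (y \in Y).
    apply: leq_trans (leq_card_setU _ _) _; rewrite leq_add2r; exact: leq_card_setU.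
  rewrite -bE => h.
  have := leq_mul (leqnn (16 * m)) h; have := leq_mul km (leqnn #|nbrs x :&: X|).
  move: dx kx cR; rewrite !mulnDr !mulnDl => dx kx cR h4 h5.
  rewrite -(@leq_pmul2l m) //; last by lia.
  lia.
move: h3 h1 h2 cX; clear => h3 h1 h2 cX; have := leq_mul (leqnn (2 * c)) h3.
by rewrite !mulnDr; lia.
Qed.

(* Typical vertices of X have 3/8 n neighbours of one sign in Y, while
   #|Y| <= 5/8 n since the same holds with X and Y exchanged. *)
Lemma bipartite_twins (c k : nat) X Y F : [disjoint X & Y] ->
  n <= c * #|X| -> n <= c * #|Y| -> 16 * m * #|~: (X :|: Y)| <= n ->
  16 * m <= k -> 8 * c <= k -> 4 * c * k * arcs X X <= n * n ->
  4 * c * k * arcs Y Y <= n * n -> 8 * c <= n ->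
  4 * c * (#|F| + independence_number (underlying D)) < n ->
  exists b x v, [/\ x \in X :\: F, v \in X :\: F, D x v
    & n <= 8 * #|nbr b x :&: nbr b v :&: Y|].
Proof.
move=> dXY cX cY cR km kc sX sY cn cF.
have wX := wide_card cX cR km kc sX cn.
rewrite setUC in cR; have wY := wide_card cY cR km kc sY cn.
have n0 : 0 < n by lia.
have sub A B b : 0 < #|wide A B b| -> 3 * n <= 8 * #|B|.
  rewrite card_gt0 => /set0Pn[x]; rewrite inE => /andP[_ h]; apply: leq_trans h _.
  by rewrite leq_mul2l subset_leq_card // subsetIr.
have big A B : n <= 2 * c * (#|wide A B true| + #|wide A B false|) -> 3 * n <= 8 * #|B|.
  move=> h; have [w1|/sub //] := posnP #|wide A B true|.
  have [w2|/sub //] := posnP #|wide A B false|.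
  by move: h; rewrite w1 w2 muln0 leqNgt n0.
have hX := big _ _ wY.
have hY : 8 * #|Y| <= 5 * n.
  have : #|X| + #|Y| <= n.
    by rewrite -[X in X <= _]subn0 -[0](cards0 T) -(disjoint_setI0 dXY) -cardsU -nT max_card.
  by lia.
have [b wb] : exists b, n <= 4 * c * #|wide X Y b|.
  have [h|h] := leqP #|wide X Y true| #|wide X Y false|; [exists false|exists true].
    by apply: leq_trans wX _; have := leq_mul (leqnn (2 * c)) h; clear; lia.
  by apply: leq_trans wX _; have := leq_mul (leqnn (2 * c)) (ltnW h); clear; lia.
have [|x [v [xW vW xv]]] := @dense_edge (wide X Y b :\: F).
  rewrite ltnNge; apply/negP => h; move: cF; rewrite ltnNge => /negP; apply.
  apply: leq_trans wb _; rewrite leq_mul2l; apply/orP; right.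
  by apply: leq_trans (cardsID_le _ F) _; rewrite addnC leq_add2l.
move: xW vW; rewrite !inE => /and3P[xF xX hx] /and3P[vF vX hv].
exists b, x, v; rewrite !inE xF vF xX vX; split=> //.
have := cardsUI (nbr b x :&: Y) (nbr b v :&: Y).
have -> : nbr b x :&: Y :&: (nbr b v :&: Y) = nbr b x :&: nbr b v :&: Y.
  by rewrite setIACA setIid.
have : #|(nbr b x :&: Y) :|: (nbr b v :&: Y)| <= #|Y|.
  by apply: subset_leq_card; rewrite subUset !subsetIr.
by move: hx hv hY; clear; lia.
Qed.

End Degrees.

(** * Classes of a relation that is not transitive *)

Section Partition.
Variable T : finType.
Implicit Types (I J A B : {set T}) (R : rel T).

Definition scattered R I := [forall x in I, forall y in I, (x != y) ==> ~~ R x y].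

Lemma scatteredPn R I : ~~ scattered R I ->
  exists x y, [/\ x \in I, y \in I, x != y & R x y].
Proof.
rewrite negb_forall_in => /exists_inP[x xI]; rewrite negb_forall_in => /exists_inP[y yI].
by rewrite negb_imply negbK => /andP[xy Rxy]; exists x, y.
Qed.

Lemma scatteredP R I x y : scattered R I -> x \in I -> y \in I -> x != y -> ~~ R x y.
Proof. by move=> /forall_inP H xI yI; move: (H x xI) => /forall_inP/(_ y yI)/implyP; apply. Qed.

Lemma leq_card_bigcup (K : finType) (P : pred K) (F : K -> {set T}) :
  #|\bigcup_(i | P i) F i| <= \sum_(i | P i) #|F i|.
Proof.
apply: (big_ind2 (fun (A : {set T}) k => #|A| <= k)); rewrite ?cards0 //.
by move=> A a B b Aa Bb; apply: leq_cardU.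
Qed.

(** The largest size of a scattered set does not increase with the level and starts below [r], so it
    cannot drop at each of the first [r] levels. At a level without a drop, a largest set scattered
    for the coarser relation is also of maximal size for the finer one. *)
Lemma stable_level (R_ : nat -> rel T) r :
  (forall j x y, R_ j x y -> R_ j.+1 x y) ->
  (forall I, scattered (R_ 0) I -> #|I| < r) ->
  exists j I, [/\ j < r, #|I| < r, scattered (R_ j.+1) I
    & forall J, #|I| < #|J| -> ~~ scattered (R_ j) J].
Proof.
move=> mono small.
pose f j := \max_(I : {set T} | scattered (R_ j) I) #|I|.
have sc0 j : scattered (R_ j) set0 by apply/forall_inP => x; rewrite inE.
have fmax j : exists2 I : {set T}, scattered (R_ j) I & #|I| = f j.
  have [|I sI fE] := @eq_bigmax_cond _ (scattered (R_ j)) (fun I => #|I|); last by exists I.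
  by apply/card_gt0P; exists set0; exact: sc0.
have fdec j I : scattered (R_ j.+1) I -> scattered (R_ 0) I.
  elim: j I => [|j IH] I sI; [|apply: IH]; apply/forall_inP => x xI; apply/forall_inP => y yI;
  by apply/implyP => xy; move: (scatteredP sI xI yI xy); apply: contra; apply: mono.
have [j jr fj] : exists2 j, j < r & f j <= f j.+1.
  have [/existsP[j fj]|] := boolP [exists j : 'I_r, f j <= f j.+1]; first by exists j.
  rewrite negb_exists => /forallP no; exfalso.
  have dec j : j <= r -> f j + j <= f 0.
    elim: j => [|j IH] jr; first by rewrite addn0.
    by have := no (Ordinal jr); rewrite -ltnNge /=; have := IH (ltnW jr); lia.
  have [I sI IE] := fmax 0.
  by have := small I sI; have := dec r (leqnn r); lia.
have [I sI IE] := fmax j.+1.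
exists j, I; split=> //; first by apply: small; apply: (fdec j).
move=> J; rewrite IE => ltJ; apply/negP => sJ.
by have := @leq_bigmax_cond _ (scattered (R_ j)) (fun I => #|I|) _ sJ; rewrite -/(f j); lia.
Qed.

Variables (R R' : rel T) (I : {set T}).
Hypotheses (Rxx : reflexive R) (Rsym : symmetric R) (RR' : forall x y, R x y -> R' x y).
Hypotheses (sI : scattered R' I) (mI : forall J, #|I| < #|J| -> ~~ scattered R J).

Definition own_class i := [set w | R i w & [forall j in I, (j != i) ==> ~~ R j w]].

Lemma mem_own_class i : i \in I -> i \in own_class i.
Proof.
move=> iI; rewrite inE Rxx; apply/forall_inP => j jI; apply/implyP => ji.
by move: (scatteredP sI jI iI ji); apply: contra; apply: RR'.
Qed.

Lemma own_class_root i w : w \in own_class i -> R i w.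
Proof. by rewrite inE => /andP[]. Qed.

Lemma own_class_other i j w : w \in own_class i -> j \in I -> j != i -> ~~ R j w.
Proof. by rewrite inE => /andP[_ /forall_inP H] /H/implyP; apply. Qed.

Lemma own_class_disjoint i j : i \in I -> j \in I -> i != j -> [disjoint own_class i & own_class j].
Proof.
move=> iI jI ij; rewrite disjoint_subset; apply/subsetP => w wi; rewrite inE.
apply/negP => wj; have := own_class_root wi; apply/negP; exact: own_class_other wj iI ij.
Qed.

(* Replacing i by u and w in I gives a larger set, hence an R-related pair. *)
Lemma own_class_pair i u w : i \in I -> u \in own_class i -> w \in own_class i -> R u w.
Proof.
move=> iI ui wi; have [->//|uw] := eqVneq u w.
have out z : z \in own_class i -> z \notin I :\ i.
  by move=> zi; rewrite !inE negb_and negbK; apply/norP => -[zni]; rewrite negbK => zI;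
  have := own_class_other zi zI zni; rewrite Rxx.
have /mI/scatteredPn[x [y [xJ yJ xy Rxy]]] : #|I| < #|u |: (w |: (I :\ i))|.
  by rewrite !cardsU1 !inE (negbTE uw) -!in_setD1 (out _ wi) (out _ ui) (cardsD1 i I) iI; lia.
have inI z : z \in I :\ i -> (z \in I) /\ z != i by rewrite !inE => /andP[].
have no z v : z \in own_class i -> v \in I :\ i -> ~~ R v z.
  by move=> zi /inI[vI vi]; apply: own_class_other zi vI vi.
move: xJ yJ Rxy; rewrite !in_setU !in_set1.
case/or3P => [/eqP xE|/eqP xE|xI] /or3P[/eqP yE|/eqP yE|yI]; rewrite ?xE ?yE.
- by rewrite xE yE eqxx in xy.
- by [].
- by rewrite Rsym (negbTE (no u y ui yI)).
- by rewrite Rsym.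
- by rewrite xE yE eqxx in xy.
- by rewrite Rsym (negbTE (no w y wi yI)).
- by rewrite (negbTE (no u x ui xI)).
- by rewrite (negbTE (no w x wi xI)).
- have [xI' _] := inI _ xI; have [yI' _] := inI _ yI.
  by move/RR'; rewrite (negbTE (scatteredP sI xI' yI' xy)).
Qed.

(** By maximality of [I] every vertex is related to some member of [I]; outside the classes it is
    related to two of them. *)
Lemma own_class_cover t :
  (forall i j, i \in I -> j \in I -> i != j -> #|[set w | R i w && R j w]| <= t) ->
  #|~: \bigcup_(i in I) own_class i| <= #|I| * #|I| * t.
Proof.
move=> Bt.
apply: (@leq_trans #|\bigcup_(i in I) \bigcup_(j in I | i != j) [set w | R i w && R j w]|).
  apply/subset_leq_card/subsetP => w; rewrite inE => wn.
  have [i iI Riw] : exists2 i, i \in I & R i w.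
    have [wI|wI] := boolP (w \in I); first by exists w.
    have /mI/scatteredPn[x [y []]] : #|I| < #|w |: I| by rewrite cardsU1 wI; lia.
    rewrite !in_setU1 => /orP[/eqP->|xI] /orP[/eqP->|yI] xy Rxy.
    - by rewrite eqxx in xy.
    - by exists y; rewrite // Rsym.
    - by exists x.
    - by have := scatteredP sI xI yI xy; rewrite (RR' Rxy).
  have : w \notin own_class i by apply: contra wn => wi; apply/bigcupP; exists i.
  rewrite inE Riw /= negb_forall_in => /exists_inP[j jI]; rewrite negb_imply negbK => /andP[ji Rjw].
  apply/bigcupP; exists i => //; apply/bigcupP; exists j; first by rewrite jI eq_sym.
  by rewrite inE Riw.
apply: leq_trans (leq_card_bigcup _ _) _; rewrite -mulnA -sum_nat_const leq_sum // => i iI.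
apply: leq_trans (leq_card_bigcup _ _) _; rewrite -sum_nat_const.
rewrite big_mkcond [X in _ <= X]big_mkcond leq_sum // => j _.
by case: (boolP (j \in I)) => //= jI; case: eqVneq => //= ij; apply: Bt.
Qed.

End Partition.

(** * Pigeonhole on neighbourhoods *)

Section CommonNeighbours.
Variables (T : finType) (D : rel T) (n : nat).
Hypothesis nT : #|T| = n.
Local Notation nbr := (nbr D).

(** Among [4 * M] vertices, [2 * M] have the same sign. Their neighbourhoods have total size at
    least [2 * n], so the pairwise intersections together have at least [n] elements. *)
Lemma common_neighbours (M t : nat) (sg : T -> bool) (I : {set T}) :
  0 < M -> (forall v, n <= M * #|nbr (sg v) v|) -> 4 * M * M * t < n -> 4 * M <= #|I| ->
  exists u v b, [/\ u \in I, v \in I, u != v & t <= #|nbr b u :&: nbr b v|].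
Proof.
move=> M0 deg tn cI.
have [b cb] : exists b, 2 * M <= #|[set v in I | sg v == b]|.
  have : #|I| <= #|[set v in I | sg v == true]| + #|[set v in I | sg v == false]|.
    apply: leq_trans (leq_card_setU _ _); apply/subset_leq_card/subsetP => v vI.
    by rewrite !inE vI; case: (sg v).
  move=> h; have [h'|h'] := leqP (2 * M) #|[set v in I | sg v == true]|; first by exists true.
  by exists false; lia.
have [K KI' cK] := subset_of_card cb.
have KI v : v \in K -> v \in I /\ sg v = b.
  by move/(subsetP KI'); rewrite inE => /andP[-> /eqP].
have [/exists_inP[u uK /exists_inP[v vK /andP[uv h]]]|no] :=
    boolP [exists u in K, exists v in K, (u != v) && (t <= #|nbr b u :&: nbr b v|)].
  by exists u, v, b; split=> //; [case: (KI u)|case: (KI v)].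
exfalso.
have {}no u v : u \in K -> v \in K -> u != v -> #|nbr b u :&: nbr b v| <= t.
  move=> uK vK uv; rewrite leqNgt; apply: contra no => h.
  by apply/exists_inP; exists u => //; apply/exists_inP; exists v; rewrite // uv ltnW.
have lo : #|K| * n <= M * \sum_(v in K) #|nbr b v|.
  rewrite -sum_nat_const big_distrr leq_sum //= => v /KI[_ <-]; exact: deg.
(* For a point [z] in some neighbourhood, one index [u] accounts for the summand 1, and all other
   indices are counted in the pairs with this [u]. *)
have hi : \sum_(v in K) #|nbr b v| <=
    n + \sum_(u in K) \sum_(v in K | u != v) #|nbr b u :&: nbr b v|.
  have cE (A : {set T}) : #|A| = \sum_z (z \in A).
    by rewrite -sum1_card big_mkcond; apply: eq_bigr => z _; case: ifP.
  under eq_bigr => v _ do rewrite cE.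
  under [X in _ <= _ + X]eq_bigr => u _ do
    (under eq_bigr => v _ do rewrite cE; rewrite exchange_big).
  rewrite exchange_big [X in _ <= _ + X]exchange_big -nT -[#|T|]sum1_card -big_split.
  rewrite leq_sum //= => z _.
  have [/existsP[u /andP[uK zu]]|none] :=
    boolP [exists u, (u \in K) && (z \in nbr b u)]; last first.
    rewrite big1 // => u uK; case: (boolP (z \in nbr b u)) => // zu.
    by case/negP: none; apply/existsP; exists u; rewrite uK.
  rewrite (bigD1 u) //= zu leq_add2l.
  rewrite [X in _ <= X](bigD1 u) //=; apply: leq_trans (leq_addr _ _).
  rewrite leq_eqVlt; apply/orP; left; apply/eqP; apply: eq_big => v; first by rewrite eq_sym.
  by rewrite in_setI zu.
have hi2 : \sum_(u in K) \sum_(v in K | u != v) #|nbr b u :&: nbr b v| <= #|K| * (#|K| * t).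
  rewrite -sum_nat_const leq_sum // => u uK; rewrite -sum_nat_const.
  rewrite big_mkcond [X in _ <= X]big_mkcond leq_sum // => v _.
  by case: (boolP (v \in K)) => //= vK; case: eqVneq => //= uv; apply: no.
have := leq_trans lo (leq_mul (leqnn M) (leq_trans hi (leq_add (leqnn n) hi2))).
rewrite cK; move: M0 tn; clear => M0 tn h.
have : M * (2 * n) <= M * (n + 2 * M * (2 * M * t)) by move: h; clear; lia.
by rewrite leq_pmul2l //; move: tn; clear; lia.
Qed.

End CommonNeighbours.

(** * Reachability between vertices of different classes *)

Section Merging.
Variables (l : nat) (C : rel 'I_l).
Hypotheses (l3 : 3 <= l) (oC : cycle_orientation C) (nC : ~ consistently_directed C).
Variables (T : finType) (D : rel T) (n : nat).
Hypothesis oD : oriented_graph D.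
Hypothesis nT : #|T| = n.
Implicit Types (A B F P H X Y : {set T}).
Local Notation nbr := (nbr D).
Local Notation arcs := (arcs D).
Local Notation reach := (reach C D).
Local Notation tile := (tile C D).
Local Notation thr := (path_threshold l D).

Lemma set_enum_seq P : [set:: enum P] = P.
Proof. by apply/setP => x; rewrite inE mem_enum. Qed.

Lemma zip_reach q K (s s' : seq T) H :
  (forall x y, x \in H -> y \in H -> x != y -> reach q K x y) ->
  {subset s <= H} -> {subset s' <= H} -> (forall z, z \in s -> z \notin s') ->
  all (fun p => reach q K p.1 p.2) (zip s s').
Proof.
move=> rH; elim: s s' => [|x s IH] [|y s'] //= sH sH' d; rewrite IH ?andbT.
- apply: rH; [by apply: sH; rewrite mem_head|by apply: sH'; rewrite mem_head|].
  by apply: contraNneq (d x (mem_head _ _)) => ->; rewrite mem_head.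
- by move=> z zs; apply: sH; rewrite inE zs orbT.
- by move=> z zs; apply: sH'; rewrite inE zs orbT.
- by move=> z zs; have := d z; rewrite !inE zs orbT negb_or => /(_ isT)/andP[].
Qed.

Lemma dense_tile c A H F : n * n <= c * arcs A H -> c * (2 * #|F| + 2 * thr) < n ->
  exists x P, [/\ x \in A, P \subset H, [disjoint x |: P & F], #|P| = l.-1
    & tile (x |: P)].
Proof.
move=> dAH cF; have [x [b [xA cW]]] := dense_star nT dAH cF.
have [P [PW cP tP]] := star_tile l3 oC nC oD b cW.
exists x, P; move: xA; rewrite inE => /andP[xF xA]; split=> //.
- by apply: subset_trans PW _; apply/subsetP => z; rewrite !inE => /andP[_ /andP[]].
- rewrite !disjE xF disjoint_subset; apply/subsetP => z /(subsetP PW); rewrite !inE.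
  by case/andP => _ /andP[].
- by apply: tP; apply: subset_trans PW _; rewrite subsetIl.
Qed.

(** Two disjoint copies, each with one vertex in [A] or [B] respectively and all others in [H],
    agree up to reachability except for that one vertex; [reach_exchange] applies. *)
Lemma merge_common c q K q' u w A B H :
  (forall x, x \in A -> x != u -> reach q K u x) ->
  (forall x, x \in B -> x != w -> reach q K w x) ->
  (forall x y, x \in H -> y \in H -> x != y -> reach q K x y) ->
  n * n <= c * arcs A H -> n * n <= c * arcs B H ->
  c * (2 * (q' + 4 + l) + 2 * thr) < n -> q' + 2 * l.+1 + l.+1 * K <= q ->
  reach q' (l.+1 * K + 2 * l) u w.
Proof.
move=> rA rB rH dA dB cq qq; apply: reach_exchange qq; last by move: l3; clear; lia.
move=> F0 cF0; pose F := F0 :|: [set u; w].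
have cF : #|F| <= q' + 4.
  have c2 : #|[set u; w]| <= 2 by rewrite cards2; case: (_ != _).
  by have := leq_cardU cF0 c2; rewrite -/F -addnA.
have le k : k <= q' + 4 + l -> c * (2 * k + 2 * thr) < n.
  move=> kl; apply: leq_ltn_trans cq; rewrite leq_mul2l; apply/orP; right.
  by rewrite leq_add2r leq_mul2l kl orbT.
have [|x [P [xA PH dP cP tP]]] := dense_tile (F := F) dA.
  by apply: le; apply: leq_trans cF _; rewrite leq_addr.
have [|y [P' [yB PH' dP' cP' tP']]] := dense_tile (F := F :|: (x |: P)) dB.
  by apply: le; apply: leq_cardU => //; rewrite (tile_card tP).
have ss : size (enum P) = size (enum P') by rewrite -!cardE cP cP'.
have u1 : unzip1 (zip (enum P) (enum P')) = enum P by rewrite unzip1_zip // ss.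
have u2 : unzip2 (zip (enum P) (enum P')) = enum P' by rewrite unzip2_zip // ss.
exists x, y, (zip (enum P) (enum P')); rewrite u1 u2 !set_cons !set_enum_seq.
move: dP'; rewrite disjointUr => /andP[dyF dyx].
have Fuw : u \in F /\ w \in F by rewrite !inE !eqxx !orbT.
have F0F : F0 \subset F by rewrite subsetUl.
split.
- by [].
- by rewrite disjoint_sym.
- by rewrite disjoint_sym disjointUl !(disjointWr F0F).
- split; last by rewrite size_zip -!cardE cP cP' minnn.
  apply: zip_reach rH _ _ _.
  + by move=> z; rewrite mem_enum => /(subsetP PH).
  + by move=> z; rewrite mem_enum => /(subsetP PH').
  + move=> z; rewrite !mem_enum => zP; apply: contraL dyx => zP'.
    by apply/pred0Pn; exists z; rewrite /= !inE zP zP' !orbT.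
- case: Fuw => uF wF; split; [apply: rA => //|apply: rB => //].
    by apply: contraTneq uF => <-; rewrite (disjointFr dP) // !inE eqxx.
  by apply: contraTneq wF => <-; rewrite (disjointFr dyF) // !inE eqxx.
Qed.

(* A copy with one vertex in X and a copy with two vertices in X differ, up to
   reachability, by one vertex of X against one vertex of Y. *)
Lemma merge_bipartite c q K q' u w X Y :
  (forall x, x \in Y -> x != u -> reach q K u x) ->
  (forall x, x \in X -> x != w -> reach q K w x) ->
  (forall x y, x \in X -> y \in X -> x != y -> reach q K x y) ->
  (forall x y, x \in Y -> y \in Y -> x != y -> reach q K x y) ->
  n * n <= c * arcs X Y ->
  (forall F, #|F| <= q' + 4 + l -> exists b x v, [/\ x \in X :\: F, v \in X :\: F, D x v
    & thr <= #|(nbr b x :&: nbr b v :&: Y) :\: F|]) ->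
  c * (2 * (q' + 4 + l) + 2 * thr) < n -> q' + 2 * l.+1 + l.+1 * K <= q ->
  reach q' (l.+1 * K + 2 * l) u w.
Proof.
move=> rY rX rXX rYY dXY twin cq qq; apply: reach_exchange qq; last by move: l3; clear; lia.
move=> F0 cF0; pose F := F0 :|: [set u; w].
have cF : #|F| <= q' + 4.
  have c2 : #|[set u; w]| <= 2 by rewrite cards2; case: (_ != _).
  by have := leq_cardU cF0 c2; rewrite -/F -addnA.
have [|x [P [xX PY dP cP tP]]] := dense_tile (F := F) dXY.
  apply: leq_ltn_trans cq; rewrite leq_mul2l; apply/orP; right.
  by rewrite leq_add2r leq_mul2l (leq_trans cF) // leq_addr.
have [|b [x' [v [xX' vX xv cW]]]] := twin (F :|: (x |: P)).
  by apply: leq_cardU => //; rewrite (tile_card tP).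
have [|P' [PW' cP' tP']] := twin_tile l3 oC nC oD (b := b) xv cW.
  by apply: subset_trans (subsetDl _ _) _; rewrite subsetIl.
have PY' : P' \subset Y.
  by apply: subset_trans PW' _; apply: subset_trans (subsetDl _ _) _; rewrite subsetIr.
have [p [ps pE]] : exists p ps, enum P = p :: ps.
  have : 0 < size (enum P) by rewrite -cardE cP; move: l3; clear; lia.
  by case: (enum P) => // p ps _; exists p, ps.
have sps : size ps = l.-2.
  by have := cP; rewrite cardE pE /= => e; rewrite -[size ps]/((size ps).+1.-1) e.
have mP z : (z \in P) = (z == p) || (z \in ps) by rewrite -mem_enum pE inE.
have s1 : size ps = size (enum P') by rewrite sps -cardE cP'.
pose s := (x, x') :: zip ps (enum P').
have u1 : unzip1 s = x :: ps by rewrite /s /= [unzip1 _]unzip1_zip // s1.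
have u2 : unzip2 s = x' :: enum P' by rewrite /s /= [unzip2 _]unzip2_zip // s1.
have AE : [set:: p :: x :: ps] = x |: P.
  by apply/setP => z; rewrite !inE mP orbCA.
have BE : [set:: v :: x' :: enum P'] = [set x'; v] :|: P'.
  by apply/setP => z; rewrite !inE mem_enum orbA [(z == v) || _]orbC.
have Fuw : u \in F /\ w \in F by rewrite !inE !eqxx !orbT.
have F0F : F0 \subset F by rewrite subsetUl.
have dB : [disjoint [set x'; v] :|: P' & F :|: (x |: P)].
  move: xX' vX; rewrite !in_setD => /andP[nx' _] /andP[nv _].
  rewrite !disjointUl !disjoints1 nx' nv /=.
  by rewrite disjoint_subset; apply/subsetP => z /(subsetP PW'); rewrite in_setD => /andP[].
move: dB; rewrite disjointUr => /andP[dBF dBA].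
exists p, v, s; rewrite u1 u2 AE BE; split.
- by [].
- by rewrite disjoint_sym.
- by rewrite disjoint_sym disjointUl !(disjointWr F0F).
- split; last by rewrite /= size_zip -s1 minnn sps; move: l3; clear; lia.
  rewrite /s /=; apply/andP; split.
    apply: rXX => //; first by move: xX'; rewrite inE => /andP[].
    apply: contraTneq dBA => ->; apply/pred0Pn; exists x'.
    by rewrite /= !inE !eqxx.
  apply: zip_reach rYY _ _ _.
  + by move=> z zps; apply: (subsetP PY); rewrite mP zps orbT.
  + by move=> z; rewrite mem_enum => /(subsetP PY').
  + move=> z zps; rewrite mem_enum; apply: contraL dBA => zP'.
    by apply/pred0Pn; exists z; rewrite /= !inE mP zps zP' !orbT.
- case: Fuw => uF wF; split; [apply: rY|apply: rX].
  + by apply: (subsetP PY); rewrite mP eqxx.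
  + by apply: contraTneq uF => <-; rewrite (disjointFr dP) // !inE mP eqxx orbT.
  + by move: vX; rewrite inE => /andP[].
  + by apply: contraTneq wF => <-; rewrite (disjointFr dBF) // !inE eqxx orbT.
Qed.

End Merging.

(** * A reachability class containing almost all vertices *)

Section ClosedClass.
Variables (l : nat) (C : rel 'I_l) (m : nat).
Hypotheses (l3 : 3 <= l) (oC : cycle_orientation C) (nC : ~ consistently_directed C).
Hypothesis m2 : 2 <= m.

(** Gadget sizes: level 0 comes from [reach_common], and each further level from one application of
    [reach_exchange]. *)
Fixpoint level j := if j is j'.+1 then l.+1 * level j' + 2 * l else l.-1.

Lemma level_mono i j : i <= j -> level i <= level j.
Proof.
elim: j => [|j IH]; first by rewrite leqn0 => /eqP->.
rewrite leq_eqVlt => /orP[/eqP->//|]; rewrite ltnS => /IH h; apply: leq_trans h _ => /=.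
by rewrite mulSn -addnA leq_addr.
Qed.

(** [r] bounds the number of classes: star degrees are at least [n / (2 * m)], and among [8 * m]
    vertices two have a large common neighbourhood of one sign. [step] is what the admissible size
    of forbidden sets loses per level. *)
Local Notation r := (8 * m).
Local Notation step := (l.+1 * (level r + 2)).

Variables (T : finType) (D : rel T) (n : nat).
Hypothesis oD : oriented_graph D.
Hypothesis nT : #|T| = n.
Hypothesis mn : m < n.
Hypothesis ore : forall x y, x != y -> ~~ underlying D x y ->
  (3 * m + 4) * n <= 4 * m * (stardeg D x + stardeg D y).
Implicit Types (A B F P Q X Y J : {set T}).
Local Notation nbr := (nbr D).
Local Notation arcs := (arcs D).
Local Notation reach := (reach C D).
Local Notation thr := (path_threshold l D).

Lemma arcs_bigcup P (I : finType) (J : {set I}) (F : I -> {set T}) :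
  arcs P (\bigcup_(i in J) F i) <= \sum_(i in J) arcs P (F i).
Proof.
apply: (big_ind2 (fun A k => arcs P A <= k)) => //.
- by rewrite /arcs big1 // => x _; rewrite setI0 cards0.
- by move=> A a B b Aa Bb; apply: leq_trans (arcsUr _ _ _ _) (leq_add Aa Bb).
Qed.

(** The set [B] takes at most half of the arcs, and one of the fewer than [k] parts receives its
    share of the other half. *)
Lemma dense_part c k P Q B J (F : T -> {set T}) :
  n * n <= c * arcs P Q -> Q \subset B :|: \bigcup_(i in J) F i -> 2 * c * #|B| <= n ->
  #|J| < k -> exists2 i, i \in J & n * n <= 2 * c * k * arcs P (F i).
Proof.
move=> dPQ QB cB Jk; apply/exists_inP; apply: contraT.
rewrite negb_exists_in => /forall_inP no.
have n0 : 0 < n by move: mn; clear; lia.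
have h1 : arcs P Q <= n * #|B| + \sum_(i in J) arcs P (F i).
  apply: leq_trans (arcsS D (subxx P) QB) _; apply: leq_trans (arcsUr _ _ _ _) _.
  apply: leq_add (arcs_bigcup _ _ _); apply: leq_trans (arcs_card _ _ _) _.
  by rewrite leq_mul2r -nT max_card orbT.
have h2 : 2 * c * k * (\sum_(i in J) arcs P (F i)) <= #|J| * (n * n).
  rewrite big_distrr -sum_nat_const leq_sum //= => i /no; rewrite -ltnNge => /ltnW.
  by [].
have h3 := leq_mul (leqnn (2 * k)) dPQ.
have h4 := leq_mul (leqnn (2 * c * k)) h1.
have h5 := leq_mul (leqnn (k * n)) cB.
have h6 : (#|J| + 1) * (n * n) <= k * (n * n) by rewrite leq_mul2r addn1 Jk orbT.
have n2 : 0 < n * n by rewrite muln_gt0 n0.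
move: h2 h3 h4 h5 h6 n2; clear.
move: (\sum_(i in J) _) #|J| #|B| (arcs P Q) => S j b a.
rewrite !mulnDr !mulnDl; lia.
Qed.

(** These constants are reciprocals of densities and proportions in [closed_class]: [across_const]
    concerns the cut around a large class, [pair_const] two classes with dense arcs, the [rest]
    constants the cut around their union, and [merge_const] the density at which two classes joined
    to a common one merge. [total_const] collects the requirements on [n]. *)
Definition across_const c := 8 * m * m * (c + 2 * r) * (c + 2 * r).
Definition pair_const c := 2 * across_const c * r.
Definition rest_const c := 16 * m + pair_const c.
Definition rest_across_const c := 8 * m * m * rest_const c * rest_const c.
Definition wide_const c := 16 * m + 8 * pair_const c.
Definition merge_const c :=
  4 * rest_across_const c * r + pair_const c + 4 * pair_const c * wide_const c.
Definition total_const c :=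
  16 * m * m + 2 * r * r * (across_const c + rest_across_const c + 1)
  + 2 * merge_const c + 8 * pair_const c + m + 16.
Definition class_const c := total_const c * (r * step + l + 5).

(* At a stable level all classes with a common dense neighbour class coincide. *)
Lemma closed_class c q : class_const c * (q + thr) <= n ->
  exists V : {set T}, c * #|~: V| <= n /\
    forall u v, u \in V -> v \in V -> u != v -> reach q (level r) u v.
Proof.
move=> cq; pose N0 := q + r * step + thr + l + 4.
have N0n : total_const c * N0 <= n.
  apply: leq_trans cq; rewrite /class_const -mulnA leq_mul2l; apply/orP; right.
  have t0 : 1 <= thr by [].
  rewrite /N0; move: t0; move: (r * step) (thr) => x t; clear; nia.
have N00 : 0 < N0 by rewrite /N0; clear; lia.
have sm x y : x < total_const c -> y <= N0 -> x * y < n.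
  move=> xc yN; apply: leq_trans N0n; apply: leq_ltn_trans (leq_mul (leqnn x) yN) _.
  by rewrite ltn_pmul2r.
have n0 : 0 < n by move: mn; clear; lia.
pose qj j := q + (r - j) * step.
have qjN j : qj j + thr + l + 4 <= N0.
  by rewrite /qj /N0 !leq_add2r leq_add2l leq_mul2r leq_subr orbT.
(* Every level may use up [step] of the admissible size, so that after [r] levels [q] is still
   left. *)
pose R_ j := [rel x y | (x == y) || reach (qj j) (level j) x y].
have sgE v : exists b, n <= 2 * m * #|nbr b v|.
  have [b bE] := stardeg_attained D v; exists b; rewrite -bE.
  exact: stardeg_lower.
have [sg sgn] := fin_all_exists sgE.
have Rmono j x y : R_ j x y -> R_ j.+1 x y.
  case/orP => [xy|rxy]; apply/orP; [by left|right].
  apply: reach_mono rxy; last exact: level_mono.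
  by rewrite leq_add2l leq_mul2r leq_sub2l ?orbT.
have c1E : across_const c + rest_across_const c + 1 > 0 by rewrite addn1.
have [j [I [jr Ir sI mI]]] : exists j (I : {set T}), [/\ j < r, #|I| < r, scattered (R_ j.+1) I
    & forall J : {set T}, #|I| < #|J| -> ~~ scattered (R_ j) J].
  apply: stable_level Rmono _ => I sI; rewrite ltnNge; apply/negP => rI.
  have [||||u [v [b [uI vI uv cuv]]]] :=
    @common_neighbours T D n nT (2 * m) (thr + qj 0) sg I.
  - by move: m2; clear; lia.
  - by [].
  - apply: sm; first by rewrite /total_const; clear; lia.
    by apply: leq_trans (qjN 0); clear; lia.
  - by apply: leq_trans rI; clear; lia.
  - have := scatteredP sI uI vI uv; rewrite /= (negbTE uv) /=.
    by rewrite (reach_common l3 oC nC oD cuv).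
pose q0 := qj j; pose q' := qj j.+1; pose K := level j.
have stepK : 2 * l.+1 + l.+1 * K <= step.
  by have := leq_mul (leqnn l.+1) (level_mono (ltnW jr)); rewrite -/K; clear; lia.
have qq : q' + 2 * l.+1 + l.+1 * K <= q0.
  have -> : q0 = q' + step.
    rewrite /q0 /q' /qj -addnA; congr (_ + _).
    by rewrite -mulSnr; congr (_ * _); move: jr; clear; lia.
  by rewrite -addnA leq_add2l.
have q'N : q' + thr + l + 4 <= N0 by exact: qjN.
have K'E : level j.+1 = l.+1 * K + 2 * l by [].
pose R := R_ j; pose R' := R_ j.+1.
have Rxx : reflexive R by move=> x; rewrite /R /= eqxx.
have Rsym : symmetric R by move=> x y; rewrite /R /= eq_sym reach_sym.
have RR' : forall x y, R x y -> R' x y by exact: Rmono.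
have noR' i i' : i \in I -> i' \in I -> i != i' -> ~~ reach q' (l.+1 * K + 2 * l) i i'.
  by move=> iI iI' ii; have := scatteredP sI iI iI' ii; rewrite /= negb_or => /andP[].
pose V := own_class R I.
have VV i : i \in I -> forall x y, x \in V i -> y \in V i -> x != y -> reach q0 K x y.
  move=> iI x y xV yV xy; have := own_class_pair Rxx Rsym RR' sI mI iI xV yV.
  by rewrite /R /= (negbTE xy).
have iV i : i \in I -> i \in V i by exact: (mem_own_class Rxx RR' sI).
have Vdis i i' : i \in I -> i' \in I -> i != i' -> [disjoint V i & V i'].
  exact: own_class_disjoint.
pose Bad := ~: \bigcup_(i in I) V i.
have cBad : #|Bad| <= #|I| * #|I| * (q' + 4).
  apply: (own_class_cover Rxx Rsym RR' sI mI) => i i' iI iI' ii.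
  have c2' : #|[set i; i']| <= 2 by rewrite cards2 ii.
  have c3' : #|[set w | reach q0 K i w && reach q0 K w i']| <= q' + 2.
    rewrite leqNgt; apply: contra (noR' _ _ iI iI' ii) => big.
    apply: reach_trans big _ _; first by move: qq; clear; lia.
    by rewrite mulSn; move: l3; clear => l3; have := leq_mul l3 (leqnn K); lia.
  apply: (@leq_trans (2 + (q' + 2))); last by clear; lia.
  apply: leq_trans (leq_cardU c2' c3'); apply/subset_leq_card/subsetP => w.
  rewrite !inE /R /= ![_ == w]eq_sym [reach _ _ i' w]reach_sym.
  by case: (w == i) => //=; case: (w == i') => //=; rewrite orbT.
have Kr : K <= level r by exact: level_mono (ltnW jr).
have qq0 : q <= q0 by rewrite leq_addr.
have sBad x : x * r * r < total_const c -> x * #|Bad| <= n.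
  move=> xc; apply: leq_trans (leq_mul (leqnn x) cBad) _.
  apply: leq_trans (_ : x * r * r * (q' + 4) <= _).
    by have := leq_mul (leqnn x) (leq_mul (leq_mul (ltnW Ir) (ltnW Ir)) (leqnn (q' + 4)));
      rewrite !mulnA.
  by apply: ltnW; apply: sm => //; move: q'N; clear; lia.
(* The exceptional set [Bad] is small and there are fewer than [r] classes, so one of them has
   linear size. *)
have [h hI cX] : exists2 h, h \in I & n <= 2 * r * #|V h|.
  apply/exists_inP; apply: contraT; rewrite negb_exists_in => /forall_inP no.
  have : n <= #|Bad| + \sum_(i in I) #|V i|.
    rewrite -nT -(cardsC (\bigcup_(i in I) V i)) addnC leq_add2l; exact: leq_card_bigcup.
  have := sBad 2; have h2 : 2 * r * (\sum_(i in I) #|V i|) <= #|I| * n.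
    by rewrite big_distrr -sum_nat_const leq_sum //= => i /no; rewrite -ltnNge => /ltnW.
  have lt2 : 2 * r * r < total_const c.
    rewrite /total_const; move: c1E; clear => c1E; have := leq_mul (leqnn (2 * r * r)) c1E; lia.
  move=> /(_ lt2) h1 h3; have h4 := leq_mul (leqnn (2 * r)) h3.
  have h5 : (#|I| + 1) * n <= r * n by rewrite leq_mul2r addn1 Ir orbT.
  have h6 := leq_mul (leqnn r) h1; move: h2 h4 h5 h6 n0; clear.
  by move: #|I| (\sum_(i in I) _) #|Bad| => a S b; rewrite !mulnDr !mulnDl; lia.
have [small_rest|ltc] := leqP (c * #|~: V h|) n.
  exists (V h); split=> // u v uV vV uv.
  exact: reach_mono qq0 Kr (VV h hI u v uV vV uv).
(* From here on the complement of [V h] has more than [n / c] vertices, and two members of [I] will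
   turn out to reach each other. *)
exfalso.
have VE i : i \in I -> ~: V i \subset Bad :|: \bigcup_(j in I :\ i) V j.
  move=> iI; apply/subsetP => w; rewrite !(in_setU, in_setC) => wi.
  have [/bigcupP[k kI wk]|//] := boolP (w \in \bigcup_(i in I) V i).
  apply/bigcupP; exists k => //; rewrite in_setD1 kI andbT.
  by apply: contraNneq wi => <-.
have merge i i' k : i \in I -> i' \in I -> k \in I -> i != i' ->
    n * n <= merge_const c * arcs (V i) (V k) ->
    n * n <= merge_const c * arcs (V i') (V k) -> False.
  move=> iI iI' kI ii d d'; apply/negP: (noR' i i' iI iI' ii).
  apply/negPn; apply: (merge_common l3 oC nC oD nT _ _ (VV k kI) d d' _ qq).
  - by move=> x xV xi; apply: VV xV _; rewrite ?iV // eq_sym.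
  - by move=> x xV xi; apply: VV xV _; rewrite ?iV // eq_sym.
  - rewrite -mulnDr mulnA [merge_const c * 2]mulnC; apply: sm.
      by rewrite /total_const; clear; lia.
    by move: q'N; clear; lia.
pose X := V h.
have cXr : n <= (c + 2 * r) * #|X|.
  by apply: leq_trans cX _; rewrite leq_mul2r leq_addl orbT.
have cXc : n <= (c + 2 * r) * #|~: X|.
  by apply: leq_trans (ltnW ltc) _; rewrite leq_mul2r leq_addr orbT.
have Ih : #|I :\ h| < r by apply: leq_ltn_trans Ir; rewrite subset_leq_card // subsetDl.
have [|i] := dense_part (arcs_across oD nT m2 mn ore cXr cXc) (VE h hI)
  (sBad (2 * across_const c) _) Ih.
  by rewrite /total_const; clear; lia.
rewrite !inE => /andP[ih iI]; rewrite -/(across_const c) -/(pair_const c) => dXY.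
pose Y := V i; rewrite -/X -/Y in dXY.
have dXY7 : n * n <= merge_const c * arcs X Y.
  by apply: leq_trans dXY _; rewrite leq_mul2r /merge_const; apply/orP; right; clear; lia.
have cY : n <= pair_const c * #|Y|.
  rewrite -(leq_pmul2l n0); apply: leq_trans dXY _.
  rewrite mulnCA leq_mul2l; apply/orP; right; apply: leq_trans (arcs_card _ _ _) _.
  by rewrite leq_mul2r -nT max_card orbT.
have cX3 : n <= pair_const c * #|X|.
  rewrite -(leq_pmul2l n0); apply: leq_trans dXY _.
  rewrite mulnCA leq_mul2l; apply/orP; right; rewrite arcsC; apply: leq_trans (arcs_card _ _ _) _.
  by rewrite leq_mul2r -nT max_card orbT.
(* [Y] has dense arcs to [X]; if [X] had dense arcs to itself, the two would merge over [X]. *)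
have nXX : merge_const c * arcs X X <= n * n.
  rewrite leqNgt; apply/negP => /ltnW d.
  by apply: (merge i h h) => //; rewrite arcsC.
have nYY : merge_const c * arcs Y Y <= n * n.
  rewrite leqNgt; apply/negP => /ltnW d.
  by apply: (merge i h i) => //.
have dis : [disjoint X & Y] by apply: Vdis => //; rewrite eq_sym.
(* Otherwise the cut around the union of [X] and [Y] yields a third class with dense arcs to one of
   them. Being joined to the same class as the other one, it would merge with that one. *)
have cR : 16 * m * #|~: (X :|: Y)| <= n.
  have [le|/ltnW lt4] := leqP (rest_const c * #|~: (X :|: Y)|) n.
    by apply: leq_trans le; rewrite leq_mul2r leq_addr orbT.
  exfalso.
  have cXY : n <= rest_const c * #|X :|: Y|.
    apply: leq_trans cX3 _; apply: leq_mul; first by rewrite leq_addl.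
    by rewrite subset_leq_card ?subsetUl.
  have sub : ~: (X :|: Y) \subset Bad :|: \bigcup_(j in I :\ h :\ i) V j.
    apply/subsetP => w; rewrite !(in_setU, in_setC) negb_or => /andP[wX wY].
    have [/bigcupP[k kI wk]|//] := boolP (w \in \bigcup_(i in I) V i).
    apply/bigcupP; exists k => //; rewrite !in_setD1 kI andbT; apply/andP; split.
      by apply: contraNneq wY => e; rewrite /Y -e.
    by apply: contraNneq wX => e; rewrite /X -e.
  have Ihi : #|I :\ h :\ i| < r.
    by apply: leq_ltn_trans Ih; rewrite subset_leq_card // subsetDl.
  have [|k] := dense_part (arcs_across oD nT m2 mn ore cXY lt4) sub
    (sBad (2 * rest_across_const c) _) Ihi.
    by rewrite /total_const; clear; lia.
  rewrite !inE => /and3P[ki kh kI]; rewrite -/(rest_across_const c) => dk.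
  have h1 := leq_mul (leqnn (2 * rest_across_const c * r)) (arcsUl D (V k) X Y).
  have c7ge : 4 * rest_across_const c * r <= merge_const c by rewrite /merge_const; clear; lia.
  have [le|/ltnW le] := leqP (arcs X (V k)) (arcs Y (V k)).
    apply: (merge k h i) => //; rewrite arcsC -/Y.
    apply: leq_trans (leq_mul c7ge (leqnn _)).
    move: le dk h1; clear; rewrite mulnDr => le.
    by have := leq_mul (leqnn (2 * rest_across_const c * r)) le; lia.
  apply: (merge k i h) => //; rewrite arcsC -/X -/Y //.
  apply: leq_trans (leq_mul c7ge (leqnn _)).
  move: le dk h1; clear; rewrite mulnDr => le.
  by have := leq_mul (leqnn (2 * rest_across_const c * r)) le; lia.
have ckm : 16 * m <= wide_const c by rewrite leq_addr.
have ckc : 8 * pair_const c <= wide_const c by rewrite leq_addl.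
have c7k : 4 * pair_const c * wide_const c <= merge_const c by rewrite /merge_const; clear; lia.
have sX : 4 * pair_const c * wide_const c * arcs X X <= n * n.
  by apply: leq_trans nXX; rewrite leq_mul2r c7k orbT.
have sY : 4 * pair_const c * wide_const c * arcs Y Y <= n * n.
  by apply: leq_trans nYY; rewrite leq_mul2r c7k orbT.
have c3n : 8 * pair_const c <= n.
  by rewrite -[_ * _]muln1; apply/ltnW/sm; rewrite // /total_const; clear; lia.
(* What remains is the case of two sparse classes with dense arcs between them and few vertices
   outside, where twins exist. *)
apply/negP: (noR' i h iI hI ih); apply/negPn.
apply: (merge_bipartite l3 oC nC oD nT _ _ (VV h hI) (VV i iI) dXY7 _ _ qq).
- by move=> x xV xi; apply: VV xV _; rewrite ?iV // eq_sym.
- by move=> x xV xi; apply: VV xV _; rewrite ?iV // eq_sym.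
- move=> F cF.
  have [|b [x [v [xX vX xv cb]]]] :=
    bipartite_twins nT m2 mn ore dis cX3 cY cR ckm ckc sX sY c3n (F := F).
    apply: sm; first by rewrite /total_const; clear; lia.
    have athr : independence_number (underlying D) <= thr.
      by rewrite /path_threshold ltnW // ltnS leq_pmull // expn_gt0; move: l3; case: (l).
    by apply: leq_trans (leq_add cF athr) _; move: q'N; clear; lia.
  exists b, x, v; split=> //; rewrite -/Y.
  have := cardsID_le (nbr b x :&: nbr b v :&: Y) F.
  have h8 : 8 * (thr + #|F|) < n.
    apply: sm; first by rewrite /total_const; clear; lia.
    by apply: leq_trans (leq_add (leqnn _) cF) _; move: q'N; clear; lia.
  move: cb h8; clear; lia.
- rewrite -mulnDr mulnA [merge_const c * 2]mulnC; apply: sm.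
    by rewrite /total_const; clear; lia.
  by move: q'N; clear; lia.
Qed.

End ClosedClass.

(** * A small set meeting all given neighbourhoods often, by derandomised choice *)

Section Reservoir.
Variables (T : finType) (n A : nat) (N : T -> {set T}).
Hypothesis nT : #|T| = n.

(** Bernoulli's inequality for [1 + 1/a], with denominators cleared. *)
Lemma bernoulli_pow a e : a ^ e * (a + e) <= a * a.+1 ^ e.
Proof.
elim: e => [|e IH]; first by rewrite !expn0 addn0 mul1n muln1.
rewrite !expnS; have := leq_mul (leqnn a.+1) IH.
have -> : a.+1 * (a ^ e * (a + e)) = a * a ^ e * (a + e.+1) + a ^ e * e by clear; lia.
by move=> h; apply: leq_trans (leq_addr _ _) (leq_trans h _); rewrite mulnCA.
Qed.

Hypothesis A0 : 0 < A.

(** Bernoulli on blocks of [12 * A] factors: each block gains at least [1 + 12 * A / (4 * A - 1)],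
    which exceeds 4. *)
Lemma pow_ratio d : 4 ^ d * (4 * A).-1 ^ (12 * A * d) <= (4 * A) ^ (12 * A * d).
Proof.
rewrite !(expnM _ (12 * A) d) -expnMn; case: d => [|d] //; rewrite leq_exp2r //.
have a0 : 0 < (4 * A).-1 by move: A0; clear; lia.
rewrite -(leq_pmul2l a0); have := bernoulli_pow (4 * A).-1 (12 * A).
rewrite prednK; last by move: A0; clear; lia.
move=> h; apply: leq_trans h.
have h : 4 * (4 * A).-1 <= (4 * A).-1 + 12 * A by move: A0; clear; lia.
have := leq_mul (leqnn ((4 * A).-1 ^ (12 * A))) h.
move: ((4 * A).-1 ^ (12 * A)) => x; move: (4 * A).-1 => a.
by rewrite [a * _]mulnCA [4 * (a * x)]mulnA [4 * a * x]mulnC.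
Qed.

(* The number of times each N v is hit is controlled through the potential
   sum_v 2^(k - hits v), which some choice of the next element multiplies by at
   most 1 - 1/(4A). *)
Lemma reservoir d (U : {set T}) :
  (forall v, N v \subset U) -> (forall v, n <= A * #|N v|) ->
  2 * A * (12 * A * d) <= n -> n <= 2 ^ d ->
  exists Z : {set T}, [/\ Z \subset U, #|Z| = 12 * A * d & forall v, d <= #|N v :&: Z|].
Proof.
move=> NU cN dn n2; set k := 12 * A * d in dn *.
pose w (Z : {set T}) v := 2 ^ (k - #|N v :&: Z|).
pose pot Z := \sum_v w Z v.
have step (Z : {set T}) : Z \subset U -> #|Z| < k -> exists2 z, z \in U :\: Z &
    4 * A * pot (z |: Z) <= (4 * A).-1 * pot Z.
  move=> ZU cZ; pose S z := \sum_(v | z \in N v) w Z v.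
  (* Averaging over [z]: each [N v] keeps at least [n / (2 * A)] vertices outside [Z], so some [z]
     hits sets carrying a proportion 1/(2A) of the potential. Their weights are halved, whence the
     factor 1 - 1/(4A). *)
  have [z zU zS] : exists2 z, z \in U :\: Z & pot Z <= 2 * A * S z.
    apply/exists_inP; apply: contraT; rewrite negb_exists_in => /forall_inP no.
    have [v0 _|T0] := pickP (@predT T); last first.
      have n0 : n = 0 by rewrite -nT; apply: eq_card0.
      have : 0 < 2 * A * k by rewrite muln_gt0 (leq_ltn_trans (leq0n _) cZ) andbT muln_gt0.
      by rewrite lt0n; move: dn; rewrite n0 leqn0 => ->.
    have pot0 : 0 < pot Z.
      by rewrite /pot (bigD1 v0) //= addn_gt0 expn_gt0.
    have lo : n * pot Z <= 2 * A * \sum_(z in U :\: Z) S z.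
      rewrite /S /pot (exchange_big_dep predT) //= mulnC big_distrl big_distrr leq_sum //= => v _.
      rewrite sum_nat_const mulnA [w Z v * n]mulnC leq_mul2r; apply/orP; right.
      pose hits := #|[pred z | (z \in U :\: Z) && (z \in N v)]|.
      suff : n <= 2 * A * hits by [].
      have : #|N v| <= #|Z| + hits.
        rewrite -(cardsID Z (N v)) leq_add ?subset_leq_card ?subsetIr //.
        apply/subsetP => z; rewrite !inE => /andP[-> zN].
        by rewrite zN (subsetP (NU v)).
      move=> h; have h1 := leq_trans (cN v) (leq_mul (leqnn A) h).
      have h2 := leq_mul (leqnn (2 * A)) (ltnW cZ).
      by move: h1 h2 dn; clear; rewrite !mulnDr; lia.
    have hi : 2 * A * (\sum_(z in U :\: Z) S z) <= #|U :\: Z| * (pot Z).-1.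
      rewrite big_distrr -sum_nat_const leq_sum //= => z /no; rewrite -ltnNge.
      by move: pot0; clear; lia.
    have := leq_trans lo (leq_trans hi (leq_mul (max_card (mem (U :\: Z))) (leqnn _))).
    rewrite nT leq_mul2l => /orP[/eqP n0|]; last by move: pot0; clear; lia.
    by have := max_card (mem [set v0]); rewrite nT n0 cards1.
  exists z => //; have zZ : z \notin Z by move: zU; rewrite inE => /andP[].
  have : 2 * pot (z |: Z) + S z <= 2 * pot Z.
    rewrite /pot /S [X in _ + X]big_mkcond !big_distrr -big_split leq_sum //= => v _.
    have hit : #|N v :&: (z |: Z)| = (z \in N v) + #|N v :&: Z|.
      case: (boolP (z \in N v)) => zN; last first.
        congr #|pred_of_set _|; apply/setP => y; rewrite !inE; case: eqVneq => // ->.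
        by rewrite (negbTE zN).
      rewrite setIUr; have -> : N v :&: [set z] = [set z].
        by apply/setIidPr; rewrite sub1set.
      by rewrite cardsU1 inE negb_and zZ orbT.
    rewrite /w hit; case: (z \in N v); last by rewrite add0n addn0.
    rewrite -[nat_of_bool true]/1; have lt : #|N v :&: Z| < k.
      by apply: leq_ltn_trans cZ; rewrite subset_leq_card ?subsetIr.
    have -> : k - #|N v :&: Z| = (k - (1 + #|N v :&: Z|)).+1 by move: lt; clear; lia.
    by rewrite expnS; clear; lia.
  move=> h; have h1 := leq_mul (leqnn (2 * A)) h; move: zS h1.
  rewrite -subn1 mulnBl mul1n; clear; rewrite mulnDr; lia.
have [Z [ZU cZ hZ]] : exists Z : {set T}, [/\ Z \subset U, #|Z| = k &
    (4 * A) ^ k * pot Z <= (4 * A).-1 ^ k * (n * 2 ^ k)].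
  suff: forall i, i <= k -> exists Z : {set T}, [/\ Z \subset U, #|Z| = i &
    (4 * A) ^ i * pot Z <= (4 * A).-1 ^ i * (n * 2 ^ k)] by apply.
  elim=> [_|i IH ik].
    exists set0; rewrite sub0set cards0; split=> //.
    rewrite !expn0 !mul1n /pot -nT -sum_nat_const leq_sum // => v _.
    by rewrite /w setI0 cards0 subn0.
  have [Z [ZU cZ hZ]] := IH (ltnW ik).
  have [|z zU hz] := step Z ZU; first by rewrite cZ.
  move: zU; rewrite inE => /andP[zZ zU].
  exists (z |: Z); split; first by rewrite subUset sub1set zU.
    by rewrite cardsU1 zZ cZ.
  rewrite !expnS mulnAC -mulnA -!mulnA.
  apply: leq_trans (_ : (4 * A) ^ i * ((4 * A).-1 * pot Z) <= _).
    by have := leq_mul (leqnn ((4 * A) ^ i)) hz; clear; lia.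
  by have := leq_mul (leqnn (4 * A).-1) hZ; clear; lia.
(* A vertex with fewer than [d] hits contributes at least [2 ^ (k - d).+1], whereas the potential is
   at most [n * 2 ^ k / 4 ^ d], hence at most [2 ^ (k - d)]. *)
exists Z; split=> // v; rewrite leqNgt; apply/negP => lt.
have dk : d <= k by rewrite /k leq_pmull // muln_gt0 A0.
have h1 : 2 ^ (k - d).+1 <= pot Z.
  apply: leq_trans (_ : w Z v <= _); last by rewrite /pot (bigD1 v) //= leq_addr.
  by rewrite /w leq_exp2l //; move: lt dk; clear; lia.
have a0 : 0 < (4 * A).-1 ^ k by rewrite expn_gt0; apply/orP; left; move: A0; clear; lia.
have := leq_trans (leq_mul (pow_ratio d) h1) hZ.
rewrite -/k mulnAC mulnC leq_pmul2l // => h.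
have k2 : 2 ^ k = 2 ^ d * 2 ^ (k - d) by rewrite -expnD subnKC.
have p2 : 0 < 2 ^ (k - d) by rewrite expn_gt0.
have p2d : 0 < 2 ^ d by rewrite expn_gt0.
have d4 : 4 ^ d = 2 ^ d * 2 ^ d by rewrite -expnMn.
move: h n2 p2 p2d; rewrite expnS k2 d4; move: (2 ^ d) (2 ^ (k - d)) => x y; clear.
move=> h nx y0 x0; have : x * x * (2 * y) <= x * (x * y).
  by apply: leq_trans h _; rewrite leq_mul2r nx orbT.
have : 0 < x * x * y by rewrite !muln_gt0 x0 y0.
by clear; lia.
Qed.

End Reservoir.

(** * Grouping the terms of a list inside short windows *)

Section Windows.
Variables (T : finType) (l : nat).
Hypothesis l0 : 0 < l.
Implicit Types (s : seq T) (U Q : {set T}) (S : seq {set T}).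

(** A list, not a set: a subset lying in several overlapping windows occurs once for each, and a
    grouping is then simply a subsequence. *)
Fixpoint window_sets s : seq {set T} :=
  if s is _ :: s' then
    [seq Q : {set T} <- enum (powerset [set:: take (2 * l) s]) | #|Q| == l] ++ window_sets s'
  else [::].

Lemma size_window_sets s : size (window_sets s) <= size s * 2 ^ (2 * l).
Proof.
elim: s => //= x s IH; rewrite size_cat mulSn leq_add // size_filter.
apply: leq_trans (count_size _ _) _; rewrite -cardE card_powerset leq_exp2l //.
by apply: leq_trans (card_setseq _) _; rewrite size_take_min; apply: geq_minl.
Qed.

Lemma window_setsP s Q : Q \in window_sets s -> #|Q| = l /\ {subset Q <= s}.
Proof.
elim: s => //= x s IH; rewrite mem_cat mem_filter mem_enum powersetE.
case/orP => [/andP[/eqP cQ /subsetP Qs]|/IH[cQ Qs]]; split=> // y yQ.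
  by have := Qs y yQ; rewrite inE => /mem_take.
by rewrite inE (Qs y yQ) orbT.
Qed.

Lemma window_sets_drop j s : subseq (window_sets (drop j s)) (window_sets s).
Proof.
elim: s j => [|x s IH] [|j] //; apply: subseq_trans (IH j) _.
by apply: suffix_subseq.
Qed.

(** The extremal list begins and ends with a term failing [a], hence the summand 1. *)
Lemma alternating_count (a : pred T) s :
  sorted (fun x y => a x || a y) s -> size s <= 2 * count a s + 1.
Proof.
have key x s' : path (fun x y => a x || a y) x s' -> size s' <= 2 * count a s' + a x.
  elim: s' x => //= y s' IH x /andP[axy /IH]; move: axy.
  by case: (a x); case: (a y) => //= _; lia.
by case: s => //= x s /key; case: (a x); lia.
Qed.

Lemma count_take_attained (a : pred T) s k J : k <= count a (take J s) ->
  exists2 j, j <= J & count a (take j s) = k.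
Proof.
elim: J => [|J IH]; first by rewrite take0 leqn0 => /eqP->; exists 0; rewrite ?take0.
have [le _|lt le] := leqP k (count a (take J s)).
  by have [j jJ e] := IH le; exists j; rewrite // ltnW.
exists J.+1 => //; apply/eqP; rewrite eqn_leq le andbT.
have [h|ltJ] := leqP (size s) J.
  by move: le lt; rewrite (take_oversize h) (take_oversize (leqW h)); lia.
by case: s lt le IH ltJ => // x0 s lt le _ ltJ; rewrite (take_nth x0) // -cats1 count_cat /=; lia.
Qed.

(* Grouping the surviving elements l by l: since no two consecutive elements
   are missing, each group lies in a window of length 2l. *)
Lemma group_alternating s U : uniq s ->
  sorted (fun x y => (x \notin U) || (y \notin U)) s -> l %| #|[set:: s] :\: U| ->
  exists S, [/\ subseq S (window_sets s), pairwise (fun A B : {set T} => [disjoint A & B]) S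
    & \bigcup_(A <- S) A = [set:: s] :\: U].
Proof.
pose a : pred T := [pred x | x \notin U].
have cE s' : uniq s' -> #|[set:: s'] :\: U| = count a s'.
  move=> us; rewrite -size_filter; have <- := card_uniqP (filter_uniq a us).
  by apply: eq_card => x; rewrite !inE mem_filter.
have [n] := ubnP (size s); elim: n s => // n IH s ltn us alt.
rewrite cE // => dv; have [k0|kpos] := posnP (count a s).
  exists [::]; split=> //; first exact: sub0seq.
  rewrite big_nil; apply/esym/eqP; rewrite -cards_eq0 cE // k0 //.
(* A window of length [2 * l] contains at least [l] survivors by [alternating_count]; a shorter list
   contains them by divisibility. *)
have [j jl cj] : exists2 j, j <= 2 * l & count a (take j s) = l.
  apply: count_take_attained; have := dvdn_leq kpos dv.
  have [le _|lt le] := leqP (2 * l) (size s); last by rewrite take_oversize // ltnW.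
  have := @alternating_count a _ (take_sorted (2 * l) alt).
  by rewrite size_takel //; lia.
have j0 : 0 < j by case: (j) cj => //; rewrite take0 /=; move: l0; lia.
have sE := cat_take_drop j s.
have [ut ud] : uniq (take j s) /\ uniq (drop j s) by rewrite take_uniq // drop_uniq.
have dj : [disjoint [set:: take j s] & [set:: drop j s]].
  move: us; rewrite -{1}sE cat_uniq => /and3P[_ /hasPn h _].
  rewrite disjoint_subset; apply/subsetP => x; rewrite !inE => xt.
  by apply/negP => /h; rewrite /= xt.
have [||||S [subS pS SE]] := IH (drop j s).
- by rewrite size_drop; case: (s) kpos ltn => //= x s' _; lia.
- by [].
- exact: drop_sorted.
- rewrite cE //; move: dv; rewrite -{1}sE count_cat cj dvdn_addr //.
pose Q := [set:: take j s] :\: U.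
have QW : Q \subset [set:: take (2 * l) s].
  by apply/subsetP => y; rewrite !inE => /andP[_]; rewrite -(take_takel _ jl) => /mem_take.
have cQ : #|Q| = l by rewrite cE.
exists (Q :: S); split.
- case: (s) kpos QW subS => // x s' _ QW subS.
  rewrite -[Q :: S]cat1s; apply: cat_subseq.
    by rewrite sub1seq mem_filter mem_enum powersetE cQ eqxx QW.
  move: subS; case: (j) j0 => // i _ /= h; apply: subseq_trans h _; exact: window_sets_drop.
- rewrite /= pS andbT; apply/allP => A AS.
  have AU : A \subset \bigcup_(A <- S) A by rewrite (big_rem A) //= subsetUl.
  rewrite SE in AU; apply: disjointW dj; first by rewrite subsetDl.
  by apply: subset_trans AU _; rewrite subsetDl.
- rewrite big_cons SE /Q -setDUl; congr (_ :\: _).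
  by apply/setP => y; rewrite !inE -mem_cat sE.
Qed.

Fixpoint interleave (s t : seq T) := if s is x :: s' then
  if t is y :: t' then x :: y :: interleave s' t' else s else t.

Lemma perm_interleave s t : perm_eq (interleave s t) (s ++ t).
Proof.
elim: s t => //= x s IH [|y t] /=; first by rewrite cats0.
rewrite perm_cons -[y :: t]cat1s perm_sym perm_catCA perm_cons perm_sym; exact: IH.
Qed.

Lemma interleave_alternating s t U : size s = size t -> {in s, forall x, x \notin U} ->
  sorted (fun x y => (x \notin U) || (y \notin U)) (interleave s t).
Proof.
move=> st sU; have key z : path (fun x y => (x \notin U) || (y \notin U)) z (interleave s t).
  elim: s t st sU z => [|x s IH] [|y t] //= [st] sU z.
  rewrite (sU x (mem_head x s)) orbT /=; apply: IH => // w ws; apply: sU; rewrite inE ws orbT //.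
by case: (interleave s t) key => //= x s' /(_ x)/andP[].
Qed.

End Windows.

(** * The absorbing set *)

Section Absorbing.
Variables (l : nat) (C : rel 'I_l) (T : finType) (D : rel T).
Hypothesis l0 : 0 < l.
Implicit Types (F G Q U V X Z B : {set T}) (S : seq {set T}).
Local Notation reach := (reach C D).
Local Notation tile := (tile C D).
Local Notation tileable := (tileable C D).

Variables (q K : nat) (V : {set T}).
Hypothesis rV : forall x y, x \in V -> y \in V -> x != y -> reach q K x y.
Hypothesis copyV : forall F, #|F| <= q -> exists X, [/\ tile X, X \subset V & [disjoint X & F]].

(** Absorbers are chosen one after the other, disjoint from [F] and from each other. The absorber of
    a selected [Q] is tiled together with [Q], every other one on its own. *)
Lemma absorb_family (Qs : seq {set T}) F :
  {in Qs, forall Q, [/\ #|Q| = l, Q \subset V & Q \subset F]} ->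
  #|F| + size Qs * (l * K + l) + 2 * l <= q ->
  exists G, [/\ [disjoint G & F], #|G| <= size Qs * (l * K + l)
    & forall S, subseq S Qs -> pairwise (fun A B : {set T} => [disjoint A & B]) S ->
      tileable (G :|: \bigcup_(A <- S) A)].
Proof.
elim: Qs F => [|Q Qs IH] F QsP cF.
  exists set0; rewrite cards0 -setI_eq0 set0I eqxx; split=> // S.
  by rewrite subseq0 => /eqP-> _; rewrite big_nil setU0; apply: tileable0.
have [cQ QV QF] := QsP Q (mem_head _ _).
have [|X [tX XV dXF]] := copyV (F := F).
  by move: cF; clear; lia.
pose s := zip (enum Q) (enum X).
have ss : size (enum Q) = size (enum X) by rewrite -!cardE cQ (tile_card tX).
have u1 : unzip1 s = enum Q by rewrite unzip1_zip // ss.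
have u2 : unzip2 s = enum X by rewrite unzip2_zip // ss.
have dXQ : [disjoint X & Q] by apply: disjointW dXF.
have [||||||G1 []] := @absorber l C T D q K F s.
- apply: zip_reach rV _ _ _.
  + by move=> z; rewrite mem_enum => /(subsetP QV).
  + by move=> z; rewrite mem_enum => /(subsetP XV).
  + by move=> z; rewrite !mem_enum => zQ; rewrite (disjointFl dXQ).
- by rewrite size_zip -ss minnn -cardE.
- by rewrite u1 enum_uniq.
- by rewrite u2 set_enum_seq.
- by rewrite u1 u2 !set_enum_seq disjointUr dXF.
- by move: cF => /=; clear; lia.
rewrite u1 set_enum_seq disjointUr => /andP[dG1F dG1Q] cG1 tG1 tQG1.
have [||G2 [dG2 cG2 tG2]] := IH (F :|: G1).
- move=> Q' Q'Qs; have [|cQ' Q'V Q'F] := QsP Q'; first by rewrite inE Q'Qs orbT.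
  by split=> //; apply: subset_trans Q'F _; rewrite subsetUl.
- by move: cF (leq_cardU (leqnn #|F|) cG1) => /=; clear; lia.
move: dG2; rewrite disjointUr => /andP[dG2F dG21].
exists (G1 :|: G2); split.
- by rewrite disjointUl dG1F.
- by move: (leq_cardU cG1 cG2) => /=; clear; lia.
- have SF S : subseq S Qs -> \bigcup_(A <- S) A \subset F.
    move=> /mem_subseq sS; rewrite big_seq.
    apply: (big_ind (fun A : {set T} => is_true (A \subset F))).
    + by rewrite sub0set.
    + by move=> A A' AF A'F; rewrite subUset AF.
    + by move=> A /sS AQs; have [|] := QsP A; rewrite ?inE ?AQs ?orbT.
  case=> [_ _|A S].
    have := tG2 [::] (sub0seq _) isT; rewrite !big_nil !setU0 => t2.
    by apply: tileableU => //; rewrite disjoint_sym.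
  rewrite /=; case: eqP => [-> sS /andP[/allP AS pS]|_ sS pS].
    have := tG2 S sS pS; have := SF S sS; rewrite big_cons => SF' t2.
    have -> : G1 :|: G2 :|: (Q :|: \bigcup_(A <- S) A) = (Q :|: G1) :|: (G2 :|: \bigcup_(A <- S) A).
      by apply/setP => z; rewrite !in_setU; do !case: (_ \in _).
    apply: tileableU => //; rewrite disjointUl !disjointUr.
    apply/andP; split; apply/andP; split.
    + by rewrite disjoint_sym; apply: disjointWr dG2F.
    + elim: S {sS pS SF' t2} AS => [|A' S IHS] AS; first by rewrite big_nil -setI_eq0 setI0.
      rewrite big_cons disjointUr AS ?mem_head // IHS // => A'' A''S; apply: AS.
      by rewrite inE A''S orbT.
    + by rewrite disjoint_sym.
    + by apply: disjointWr dG1F.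
  have := tG2 (A :: S) sS pS; have := SF (A :: S) sS => SF' t2.
  rewrite -setUA; apply: tileableU => //; rewrite disjointUr disjoint_sym dG21.
  by apply: disjointWr dG1F.
Qed.

(** The dummies stay in place and separate the terms from [Z], so no two consecutive terms of the
    interleaved list are missing after the removal of [U]. *)
Lemma absorbing_set Z B k : Z \subset V -> B \subset V -> [disjoint Z & B] ->
  #|Z| = k -> #|B| = k ->
  2 * k + 2 * k * 2 ^ (2 * l) * (l * K + l) + 2 * l <= q ->
  exists G, [/\ [disjoint G & Z :|: B], #|G| <= 2 * k * 2 ^ (2 * l) * (l * K + l), tileable G
    & forall U, U \subset Z -> l %| #|(Z :|: B) :\: U| -> tileable (G :|: ((Z :|: B) :\: U))].
Proof.
move=> ZV BV dZB cZ cB kq; pose s := interleave (enum B) (enum Z).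
have ps : perm_eq s (enum B ++ enum Z) by apply: perm_interleave.
have sE : [set:: s] = Z :|: B.
  by apply/setP => x; rewrite !inE (perm_mem ps) mem_cat !mem_enum orbC.
have us : uniq s.
  rewrite (perm_uniq ps) cat_uniq !enum_uniq andbT /=; apply/hasPn => x /=.
  by rewrite !mem_enum => xZ; rewrite (disjointFr dZB).
have ss : size s = 2 * k by rewrite (perm_size ps) size_cat -!cardE cZ cB; clear; lia.
have cW : size (window_sets l s) <= 2 * k * 2 ^ (2 * l) by rewrite -ss size_window_sets.
have [||G [dG cG tG]] := @absorb_family (window_sets l s) (Z :|: B).
- move=> Q /window_setsP[cQ Qs].
  have QZB : Q \subset Z :|: B by rewrite -sE; apply/subsetP => x /Qs; rewrite inE.
  by split=> //; apply: subset_trans QZB _; rewrite subUset ZV.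
- apply: leq_trans kq; rewrite leq_add2r; apply: leq_add.
    by apply: leq_trans (leq_card_setU _ _) _; rewrite cZ cB; clear; lia.
  by rewrite leq_mul2r cW orbT.
exists G; split=> //; first by apply: leq_trans cG _; rewrite leq_mul2r cW orbT.
  by have := tG [::] (sub0seq _) isT; rewrite big_nil setU0.
move=> U UZ dv; have [||S [sS pS SE]] := @group_alternating T l l0 s U us.
- apply: interleave_alternating; first by rewrite -!cardE cZ cB.
  move=> x; rewrite mem_enum => xB; apply/negP => /(subsetP UZ) xZ.
  by rewrite (disjointFr dZB xZ) in xB.
- by rewrite sE.
by rewrite -sE -SE; apply: tG.
Qed.

End Absorbing.

(** * Tiling almost all vertices, and covering the leftover by stars *)

Section AlmostTiling.
Variables (l : nat) (C : rel 'I_l) (m : nat).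
Hypotheses (l3 : 3 <= l) (oC : cycle_orientation C) (nC : ~ consistently_directed C).
Hypothesis m2 : 2 <= m.
Variables (T : finType) (D : rel T) (n : nat).
Hypothesis oD : oriented_graph D.
Hypothesis nT : #|T| = n.
Hypothesis mn : m < n.
Hypothesis ore : forall x y, x != y -> ~~ underlying D x y ->
  (3 * m + 4) * n <= 4 * m * (stardeg D x + stardeg D y).
Implicit Types (A B F P Q U W X Y Z : {set T}).
Local Notation nbr := (nbr D).
Local Notation nbrs := (nbrs D).
Local Notation arcs := (arcs D).
Local Notation tile := (tile C D).
Local Notation tileable := (tileable C D).
Local Notation thr := (path_threshold l D).

Lemma tileableD (P : {set {set T}}) Q : trivIset P -> (forall X, X \in P -> tile X) ->
  Q \in P -> tileable (cover P :\: Q).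
Proof.
move=> tP aP QP; apply/tileableP; exists (P :\ Q); split.
- by apply: trivIsetS tP; rewrite subD1set.
- apply/setP => x; rewrite !inE; apply/bigcupP/andP.
    case=> X; rewrite !inE => /andP[XQ XP] xX; split; last by apply/bigcupP; exists X.
    by move/trivIsetP: tP => /(_ _ _ XP QP XQ) d; rewrite (disjointFr d xX).
  case=> xQ /bigcupP[X XP xX]; exists X => //; rewrite !inE XP andbT.
  by apply: contraNneq xQ => <-.
- by move=> X; rewrite inE => /andP[_ /aP].
Qed.

Lemma sign_half k x W : 2 * k <= #|nbrs x :&: W| -> exists b, k <= #|nbr b x :&: W|.
Proof.
have := nbrs_card D x W; have [h _ _|h h1 h2] := leqP k #|nbr true x :&: W|; first by exists true.
by exists false; move: h h1 h2; clear; lia.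
Qed.

Section Maximal.
Variables (U A : {set T}).
Hypotheses (AU : A \subset U) (tA : tileable A).
Hypothesis maxA : forall B, B \subset U -> tileable B -> #|B| <= #|A|.
Let W := U :\: A.

Let WU : W \subset U. Proof. exact: subsetDl. Qed.

Let dWA : [disjoint W & A].
Proof. by rewrite disjoint_subset; apply/subsetP => x; rewrite !inE => /andP[]. Qed.

(** Otherwise a star inside [W] would be a further tile. *)
Lemma leftover_degree b x : x \in W -> #|nbr b x :&: W| < thr.
Proof.
move=> xW; rewrite ltnNge; apply/negP => big.
have [P [PW cP tP]] := star_tile l3 oC nC oD b big.
have xPW : x |: P \subset W.
  by rewrite subUset sub1set xW (subset_trans PW) // subsetIr.
have tX : tile (x |: P) by apply: tP; apply: subset_trans PW _; rewrite subsetIl.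
have dX : [disjoint A & x |: P] by rewrite disjoint_sym; apply: disjointWl xPW dWA.
have := maxA (B := A :|: (x |: P)); rewrite subUset AU (subset_trans xPW WU) => /(_ isT).
move/(_ (tileableU dX tA (tile_tileable tX))).
rewrite cardsU (disjoint_setI0 dX) cards0 (tile_card tX).
by move: l3; clear; lia.
Qed.

(* A tile with two vertices of large degree into the leftover W could be
   replaced by two tiles consisting of these vertices and paths in W. *)
Lemma tile_arcs_leftover (P : {set {set T}}) Q :
  trivIset P -> cover P = A -> (forall X, X \in P -> tile X) -> Q \in P ->
  \sum_(y in Q) #|nbrs y :&: W| <= #|W| + l * (2 * (thr + l)).
Proof.
move=> tP cP aP QP; have cQ := tile_card (aP _ QP).
have QA : Q \subset A by rewrite -cP; apply: bigcup_sup QP.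
have one y1 y2 : y1 \in Q -> y2 \in Q -> y1 != y2 ->
    2 * (thr + l) <= #|nbrs y1 :&: W| -> #|nbrs y2 :&: W| < 2 * (thr + l).
  move=> y1Q y2Q y12 /sign_half[b1 h1]; rewrite ltnNge; apply/negP => /sign_half[b2 h2].
  have [P1 [P1W cP1 tP1]] := star_tile l3 oC nC oD b1 (leq_trans (leq_addr _ _) h1).
  have [|P2 [P2W cP2 tP2]] := @star_tile _ _ l3 oC nC _ _ oD b2 ((nbr b2 y2 :&: W) :\: P1).
    have := cardsID_le (nbr b2 y2 :&: W) P1; move: h2; rewrite cP1; move: l3; clear; lia.
  have t1 : tile (y1 |: P1) by apply: tP1; apply: subset_trans P1W _; rewrite subsetIl.
  have t2 : tile (y2 |: P2).
    apply: tP2; apply: subset_trans P2W _; apply: subset_trans (subsetDl _ _) _.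
    by rewrite subsetIl.
  have P1W' : P1 \subset W by apply: subset_trans P1W _; rewrite subsetIr.
  have P2W' : P2 \subset W.
    by apply: subset_trans P2W _; apply: subset_trans (subsetDl _ _) _; rewrite subsetIr.
  have nW y : y \in Q -> y \notin W.
    by move=> /(subsetP QA) yA; rewrite (disjointFl dWA yA).
  have n11 : y1 \notin P1 by apply: contra (nW _ y1Q) => /(subsetP P1W').
  have n12 : y1 \notin P2 by apply: contra (nW _ y1Q) => /(subsetP P2W').
  have n21 : y2 \notin P1 by apply: contra (nW _ y2Q) => /(subsetP P1W').
  have d12 : [disjoint P1 & P2].
    rewrite disjoint_sym disjoint_subset; apply/subsetP => x /(subsetP P2W).
    by rewrite !inE => /andP[].
  have dAW X : X \subset W -> [disjoint A :\: Q & X].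
    by move=> XW; apply: disjointW XW _; [exact: subsetDl|rewrite disjoint_sym].
  have dt : [disjoint y1 |: P1 & y2 |: P2].
    by rewrite !disjE y12 n12 n21 d12.
  have dA : [disjoint A :\: Q & (y1 |: P1) :|: (y2 |: P2)].
    by rewrite !disjointUr !disjoint1r !dAW // !inE y1Q y2Q.
  have tA' : tileable (A :\: Q) by rewrite -cP; apply: tileableD.
  have := maxA (B := (A :\: Q) :|: ((y1 |: P1) :|: (y2 |: P2))).
  have sub : (A :\: Q) :|: ((y1 |: P1) :|: (y2 |: P2)) \subset U.
    have QU := subset_trans QA AU.
    rewrite !subUset !sub1set (subsetP QU _ y1Q) (subsetP QU _ y2Q).
    by rewrite (subset_trans P1W' WU) (subset_trans P2W' WU) (subset_trans (subsetDl _ _) AU).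
  move/(_ sub (tileableU dA tA' (tileableU dt (tile_tileable t1) (tile_tileable t2)))).
  rewrite cardsU (disjoint_setI0 dA) cards0 cardsU (disjoint_setI0 dt) cards0.
  rewrite (tile_card t1) (tile_card t2).
  by have := cardsID_le A Q; rewrite cQ; move: l3; clear; lia.
have [/exists_inP[y1 y1Q h1]|none] := boolP [exists y in Q, 2 * (thr + l) <= #|nbrs y :&: W|].
  rewrite (bigD1 y1) //= leq_add //; first by rewrite subset_leq_card ?subsetIr.
  apply: (@leq_trans (\sum_(y in Q) 2 * (thr + l))); last by rewrite sum_nat_const cQ.
  rewrite [X in _ <= X](bigD1 y1) //=; apply: leq_trans (leq_addl _ _).
  apply: leq_sum => y /andP[yQ yy1]; apply: ltnW.
  by apply: one h1 => //; rewrite eq_sym.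
apply: leq_trans (leq_addl _ _); rewrite -[X in X * _]cQ -sum_nat_const leq_sum // => y yQ.
apply: ltnW; rewrite ltnNge; apply: contra none => h.
by apply/exists_inP; exists y.
Qed.

(** The arcs between [A] and [W] are counted twice. There are at most [n / 3] tiles, each receiving
    little more than [#|W|] arcs. Conversely all but few vertices of [W] send nearly 3/8 [n] arcs to
    [A], as their degrees into [W] and into the complement of [U] are small. *)
Lemma leftover_card : 96 * (thr + #|~: U|) <= n -> #|W| <= 50 * l * (thr + l).
Proof.
move=> cU; have /tileableP[P [tP cP aP]] := tA.
have n0 : 0 < n by move: mn; clear; lia.
have t0 : 1 <= thr by [].
have hi : 3 * arcs A W <= n * (#|W| + l * (2 * (thr + l))).
  have cA : #|P| * l <= n.
    apply: leq_trans (_ : #|A| <= n); last by rewrite -nT max_card.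
    by move/eqP: (tP); rewrite cP => <-; rewrite -sum_nat_const leq_sum // => X /aP/tile_card->.
  have h : arcs A W <= #|P| * (#|W| + l * (2 * (thr + l))).
    rewrite /arcs -cP (big_trivIset _ tP) -sum_nat_const leq_sum //= => Q QP.
    exact: tile_arcs_leftover tP cP aP QP.
  have h3 := leq_mul (leqnn #|P|) l3; rewrite mulnC in h3.
  by have := leq_mul (leq_trans h3 cA) (leqnn (#|W| + l * (2 * (thr + l)))); move: h; clear; lia.
pose lo := [set x in W | 8 * m * stardeg D x < (3 * m + 4) * n].
(* Vertices of small star degree are pairwise adjacent, but degrees inside [W] are below [thr] for
   each sign. *)
have clo : #|lo| <= 2 * thr.
  have [->|/set0Pn[x]] := eqVneq lo set0; first by rewrite cards0.
  rewrite inE => /andP[xW dx].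
  have : #|lo| <= 1 + #|nbrs x :&: W|.
    apply: leq_trans (_ : #|x |: (nbrs x :&: W)| <= _); last by rewrite cardsU1; case: (_ \notin _).
    apply: subset_leq_card; apply/subsetP => y; rewrite inE => /andP[yW dy].
    rewrite in_setU1 in_setI yW andbT inE; have [//|yx] := eqVneq y x.
    by rewrite (low_stardeg_adjacent ore) // eq_sym.
  have := nbrs_card D x W; have := leftover_degree true xW; have := leftover_degree false xW.
  by clear; lia.
have lb : (#|W| - 2 * thr) * (3 * n - 8 * (thr + #|~: U|)) <= 8 * arcs W A.
  have h : \sum_(x in W :\: lo) (3 * n - 8 * (thr + #|~: U|)) <= 8 * arcs W A.
    apply: leq_trans (_ : \sum_(x in W :\: lo) 8 * #|nbrs x :&: A| <= _); last first.
      rewrite -big_distrr leq_mul2l; apply/orP; right.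
      rewrite /arcs big_mkcond [X in _ <= X]big_mkcond leq_sum //= => x _.
      by rewrite inE; case: (x \in W); rewrite ?andbF // andbT; case: ifP.
    apply: leq_sum => x; rewrite in_setD [x \in lo]inE => /andP[+ xW].
    rewrite xW -leqNgt /= => dx; have [b bE] := stardeg_attained D x.
    have : #|nbr b x| <= #|nbrs x :&: A| + #|nbr b x :&: W| + #|~: U|.
      apply: leq_trans (_ : #|(nbrs x :&: A) :|: (nbr b x :&: W) :|: ~: U| <= _).
        apply/subset_leq_card/subsetP => y yb; have yn := subsetP (nbr_sub D b x) _ yb.
        by rewrite !in_setU !in_setI in_setC yb yn /= in_setD; case: (y \in A); case: (y \in U).
      apply: leq_trans (leq_card_setU _ _) _; rewrite leq_add2r; exact: leq_card_setU.
    have := leftover_degree b xW; rewrite -bE => hd he.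
    have m0 : 0 < m by move: m2; clear; lia.
    have : 3 * n <= 8 * stardeg D x.
      rewrite -(leq_pmul2l m0); move: dx; clear; rewrite mulnDl; lia.
    by move: hd he; clear; lia.
  apply: leq_trans h; rewrite sum_nat_const leq_mul2r; apply/orP; right.
  by have := cardsID_le W lo; move: clo; clear; lia.
rewrite arcsC in lb; rewrite leqNgt; apply/negP => big.
(* Scaled by 96, the proportions 3/8 and 1/3 become 36 and 32; the error terms cost 1, which leaves
   35 against 32. *)
have h1 : 35 * n <= 12 * (3 * n - 8 * (thr + #|~: U|)) by move: cU; clear; lia.
have h2 := leq_mul (leqnn (#|W| - 2 * thr)) h1.
have h3 : 35 * (n * (#|W| - 2 * thr)) <= 32 * (n * (#|W| + l * (2 * (thr + l)))).
  by move: h2 lb hi; clear; rewrite !mulnDr; lia.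
have h4 : n * (35 * (#|W| - 2 * thr)) <= n * (32 * (#|W| + l * (2 * (thr + l)))).
  by move: h3; clear; lia.
have h5 : thr <= l * (thr + l).
  by apply: leq_trans (leq_addr l _) _; rewrite leq_pmull //; move: l3; clear; lia.
move: h4; rewrite leq_pmul2l //; move: h5 big; rewrite -[50 * l * _]mulnA.
have -> : l * (2 * (thr + l)) = 2 * (l * (thr + l)) by rewrite mulnCA.
by move: (l * _) => y; clear; lia.
Qed.

End Maximal.

Lemma almost_tiling U : 96 * (thr + #|~: U|) <= n ->
  exists A, [/\ A \subset U, tileable A & #|U :\: A| <= 50 * l * (thr + l)].
Proof.
move=> cU.
have ok0 : (set0 \subset U) && tileable set0 by rewrite sub0set tileable0.
have [A /andP[AU tA] mA] :=
  @arg_maxnP _ set0 (fun A => (A \subset U) && tileable A) (fun A => #|A|) ok0.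
exists A; split=> //; apply: leftover_card => // B BU tB.
by apply: mA; rewrite BU.
Qed.

(** Greedy choice: each star uses [l.-1] vertices of [Z], so at least [thr] suitable ones are left
    for the next star. *)
Lemma cover_leftover (sg : T -> bool) (d : nat) W Z : [disjoint W & Z] ->
  (forall x, x \in W -> d <= #|nbr (sg x) x :&: Z|) -> #|W| * l + thr <= d ->
  exists U, [/\ U \subset Z, #|U| <= #|W| * l & tileable (W :|: U)].
Proof.
have [k] := ubnP #|W|; elim: k W => // k IH W ltk dWZ dW cW.
have [->|/set0Pn[x xW]] := eqVneq W set0.
  by exists set0; rewrite sub0set cards0 setU0 tileable0.
have cWx := cardsD1 x W; rewrite xW in cWx.
have sWx : W :\ x \subset W by rewrite subD1set.
have [||||U' [U'Z cU' tU']] := IH (W :\ x).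
- by move: cWx ltk; clear; lia.
- exact: disjointWl sWx dWZ.
- by move=> y /(subsetP sWx)/dW.
- by apply: leq_trans cW; rewrite leq_add2r leq_mul2r cWx leq_addl orbT.
have [|P [PZ cP tP]] := @star_tile _ _ l3 oC nC _ _ oD (sg x) ((nbr (sg x) x :&: Z) :\: U').
  have := cardsID_le (nbr (sg x) x :&: Z) U'; have := dW x xW; move: cU' cW; rewrite cWx mulnDl.
  by clear; lia.
have PZ' : P \subset Z.
  by apply: subset_trans PZ _; apply: subset_trans (subsetDl _ _) _; rewrite subsetIr.
have tX : tile (x |: P).
  by apply: tP; apply: subset_trans PZ _; apply: subset_trans (subsetDl _ _) _; rewrite subsetIl.
exists (U' :|: P); split.
- by rewrite subUset U'Z.
- apply: leq_trans (leq_cardU cU' (leqnn _)) _; rewrite cP cWx mulnDl addnC.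
  by rewrite leq_add2r mul1n leq_pred.
- have -> : W :|: (U' :|: P) = (W :\ x :|: U') :|: (x |: P).
    by rewrite setUACA [_ :|: [set x]]setUC setD1K.
  apply: tileableU tU' (tile_tileable tX).
  have xZ : x \notin Z by rewrite (disjointFr dWZ xW).
  rewrite !disjE !inE eqxx /= (contra (subsetP U'Z x) xZ) /=.
  rewrite (disjointW sWx PZ' dWZ) /= disjoint_sym disjoint_subset.
  by apply/subsetP => y /(subsetP PZ); rewrite !inE => /andP[].
Qed.

End AlmostTiling.

(** * Assembling the factor *)

Section Factor.
Variables (l : nat) (C : rel 'I_l) (m : nat).
Hypotheses (l3 : 3 <= l) (oC : cycle_orientation C) (nC : ~ consistently_directed C).
Hypothesis m2 : 2 <= m.

Local Notation K := (level l (8 * m)).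
(** Reservoir and dummies have [48 * m * d] vertices each; the two summands account for these and
    for their absorbers, per unit of [d]. *)
Definition absorber_const := 96 * m + 96 * m * 2 ^ (2 * l) * (l * K + l).
Definition factor_const :=
  (class_const l m (8 * m) + 4 * m + 96 + 384 * m * m + 2) * (absorber_const + 3) + m + 1.

Variables (T : finType) (D : rel T) (n : nat).
Hypothesis oD : oriented_graph D.
Hypothesis nT : #|T| = n.
Hypothesis ore : forall x y, x != y -> ~~ underlying D x y ->
  (3 * m + 4) * n <= 4 * m * (stardeg D x + stardeg D y).
Local Notation nbr := (nbr D).
Local Notation thr := (path_threshold l D).

Lemma tileable_setT d : l %| n -> n <= 2 ^ d -> 51 * l * l * (thr + l) <= d ->
  factor_const * d <= n -> tileable C D [set: T].
Proof.
move=> ln n2 dl dn; have l0 : 0 < l by move: l3; clear; lia.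
have t0 : 1 <= thr by [].
have tl_d : thr + l <= d.
  by apply: leq_trans dl; rewrite leq_pmull // !muln_gt0 l0.
have d0 : 0 < d by move: t0 tl_d; clear; lia.
pose q := d * absorber_const + 2 * l.
have qt : q + thr <= (absorber_const + 3) * d by move: tl_d; rewrite /q mulnDl mulnC; clear; lia.
have cq x : x <= class_const l m (8 * m) + 4 * m + 96 + 384 * m * m + 2 -> x * (q + thr) <= n.
  move=> xc; apply: leq_trans dn; apply: leq_trans (leq_mul xc qt) _.
  by rewrite mulnA leq_mul2r /factor_const; apply/orP; right; clear; lia.
have mn : m < n.
  apply: leq_trans dn; apply: leq_trans (leq_pmulr _ d0).
  by rewrite /factor_const -addnA addn1 leq_addl.
(* With the constant [8 * m], the vertices outside [V] cost at most a quarter of the guaranteed star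
   degree [n / (2 * m)]. *)
have [V [cV rV]] : exists V : {set T}, 8 * m * #|~: V| <= n /\
    forall u v, u \in V -> v \in V -> u != v -> reach C D q K u v.
  apply: (@closed_class l C m l3 oC nC m2 T D n oD nT mn ore) => //.
  by apply: cq; clear; lia.
have [sg sgn] : exists sg : T -> bool, forall v, n <= 2 * m * #|nbr (sg v) v|.
  apply: (@fin_all_exists _ (fun=> bool) (fun v b => is_true (n <= 2 * m * #|nbr b v|))) => v.
  have [b bE] := stardeg_attained D v; exists b; rewrite -bE.
  exact: (stardeg_lower oD nT m2 mn ore).
pose N v := nbr (sg v) v :&: V.
have cN v : n <= 4 * m * #|N v|.
  have h : #|nbr (sg v) v| <= #|N v| + #|~: V|.
    rewrite -(cardsID V (nbr (sg v) v)) leq_add2l setDE subset_leq_card ?subsetIr //.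
  have := leq_trans (sgn v) (leq_mul (leqnn (2 * m)) h).
  by move: cV; clear; rewrite mulnDr; lia.
have m4 : 0 < 4 * m by move: m2; clear; lia.
have cV16 : 16 * #|~: V| <= n.
  by apply: leq_trans cV; rewrite leq_mul2r; apply/orP; right; move: m2; clear; lia.
have cq2 : 2 * (q + thr) <= n by apply: cq; rewrite leq_addl.
have bigV k : k <= q -> k < #|V|.
  move=> kq; have := cardsC V; rewrite nT.
  by move: cV16 cq2 t0 kq; clear; lia.
have copyV (F : {set T}) : #|F| <= q -> exists X : {set T},
    [/\ tile C D X, X \subset V & [disjoint X & F]].
  move=> cF; have [x] : exists x, x \in V :\: F.
    apply/set0Pn; rewrite -card_gt0; have := cardsID_le V F; have := bigV _ cF.
    by clear; lia.
  rewrite inE => /andP[xF xV].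
  have [|P [PN cP tP]] := star_tile l3 oC nC oD (sg x) (W := N x :\: F).
    have := cardsID_le (N x) F; have h := cq (4 * m).
    have {h} : 4 * m * (q + thr) <= n by apply: h; clear; lia.
    move/leq_trans/(_ (cN x)); rewrite leq_pmul2l //.
    by move: cF; clear; lia.
  have PNx : P \subset N x by apply: subset_trans PN _; apply: subsetDl.
  exists (x |: P); split.
  - by apply: tP; apply: subset_trans PNx _; apply: subsetIl.
  - by rewrite subUset sub1set xV (subset_trans PNx) // subsetIr.
  - rewrite disjointUl disjoints1 xF disjoint_subset; apply/subsetP => y /(subsetP PN).
    by rewrite !inE => /andP[].
have [|||Z [ZV cZ hZ]] := @reservoir T n (4 * m) N nT m4 d V _ cN.
- by move=> v; apply: subsetIr.
- apply: leq_trans (_ : 384 * m * m * (q + thr) <= _); last by apply: cq; clear; lia.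
  apply: leq_trans (_ : 384 * m * m * d <= _); first by clear; lia.
  rewrite leq_mul2l /q; apply/orP; right; apply: leq_trans (leq_addr _ _).
  apply: leq_trans (leq_addr _ _); rewrite leq_pmulr // /absorber_const.
  by rewrite addn_gt0 muln_gt0; move: m2; clear; case: m.
- by [].
set k := 12 * (4 * m) * d in cZ.
have kw : 2 * k + 2 * k * 2 ^ (2 * l) * (l * K + l) + 2 * l <= q.
  rewrite /q /absorber_const /k leq_add2r; clear.
  by move: (2 ^ _) (l * K + l) => x y; lia.
have [|B BVZ cB] := @subset_of_card _ (V :\: Z) k.
  have h : 2 * k <= q by apply: leq_trans kw; rewrite -addnA leq_addr.
  by have := cardsID_le V Z; rewrite cZ; have := bigV _ h; clear; lia.
have BV : B \subset V by apply: subset_trans BVZ _; apply: subsetDl.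
have dZB : [disjoint Z & B].
  rewrite disjoint_sym disjoint_subset; apply/subsetP => y /(subsetP BVZ).
  by rewrite !inE => /andP[].
have [G [dG cG tG aG]] := absorbing_set l0 rV copyV ZV BV dZB cZ cB kw.
(* The reservoir, the dummies and the absorbers are set aside. The rest is tiled up to a leftover
   [W], which uses up a part [Y] of the reservoir, and [G] absorbs what then remains of [Z] and
   [B]. *)
pose R := Z :|: B :|: G; pose U := ~: R.
have cR : #|R| <= q.
  apply: leq_trans kw; apply: leq_trans (leq_addr _ _).
  apply: leq_trans (leq_cardU (leqnn _) cG) _; rewrite leq_add2r.
  by apply: leq_trans (leq_card_setU _ _) _; rewrite cZ cB; clear; lia.
have [|A [AU tA cW]] := @almost_tiling l C m l3 oC nC m2 T D n oD nT mn ore U.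
  rewrite /U setCK; apply: leq_trans (_ : 96 * (q + thr) <= _); last by apply: cq; clear; lia.
  by rewrite leq_mul2l addnC leq_add2r cR orbT.
set W := U :\: A in cW.
have dUR : [disjoint U & R].
  by rewrite disjoint_sym disjoint_subset; apply/subsetP => x; rewrite !inE negbK.
have WU : W \subset U by apply: subsetDl.
have ZR : Z \subset R by rewrite /R -setUA subsetUl.
have [|||Y [YZ cY tY]] := @cover_leftover l C l3 oC nC T D oD sg d W Z.
- exact: disjointW WU ZR dUR.
- move=> x _; apply: leq_trans (hZ x) _; rewrite subset_leq_card // setSI //.
  exact: subsetIl.
- apply: leq_trans dl; have h := leq_mul cW (leqnn l).
  have h2 : thr <= l * l * (thr + l).
    by apply: leq_trans (leq_addr l _) _; rewrite leq_pmull // muln_gt0 l0.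
  have -> : 51 * l * l * (thr + l) = 50 * l * (thr + l) * l + l * l * (thr + l).
    by clear; lia.
  exact: leq_add.
pose X := (Z :|: B) :\: Y.
have TE : [set: T] = A :|: (W :|: Y) :|: (G :|: X).
  apply/esym/eqP; rewrite -subTset; apply/subsetP => x _.
  rewrite /X /W /U /R !(in_setU, in_setD, in_setC).
  by case: (x \in A); case: (x \in Z); case: (x \in B); case: (x \in G); case: (x \in Y).
have dAW : [disjoint A & W].
  by rewrite disjoint_sym disjoint_subset; apply/subsetP => x; rewrite !inE => /andP[].
have YR : Y \subset R by apply: subset_trans ZR.
have dA : [disjoint A & W :|: Y].
  by rewrite disjointUr dAW (disjointW AU YR dUR).
have ZBR : Z :|: B \subset R by apply: subsetUl.
have GR : G \subset R by apply: subsetUr.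
have XZB : X \subset Z :|: B by apply: subsetDl.
have XR : X \subset R by apply: subset_trans XZB ZBR.
have dGX : [disjoint G & X] by apply: disjointWr XZB dG.
have dYG : [disjoint Y & G].
  by rewrite disjoint_sym; apply: disjointWr dG; apply: subset_trans YZ _; apply: subsetUl.
have dYX : [disjoint Y & X].
  by rewrite disjoint_sym disjoint_subset; apply/subsetP => x; rewrite !inE => /andP[].
have dAll : [disjoint A :|: (W :|: Y) & G :|: X].
  rewrite !disjointUl !disjointUr dYG dYX.
  rewrite (disjointW AU GR dUR) (disjointW AU XR dUR).
  by rewrite (disjointW WU GR dUR) (disjointW WU XR dUR).
have cardU (P Q : {set T}) : [disjoint P & Q] -> #|P :|: Q| = #|P| + #|Q|.
  by move=> dPQ; rewrite cardsU (disjoint_setI0 dPQ) cards0 subn0.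
have tAW : tileable C D (A :|: (W :|: Y)) by apply: tileableU.
rewrite TE; apply: tileableU => //; apply: aG => //.
(* All other pieces are tileable, so the number of vertices to be absorbed inherits divisibility
   from [n]. *)
have := ln; rewrite -nT -cardsT TE cardU // dvdn_addr ?(tileable_dvd tAW) //.
by rewrite cardU // dvdn_addr ?(tileable_dvd tG).
Qed.

End Factor.

(** * Choice of the constants and passage from real to integer bounds *)

Lemma linear_leq_pow2 b d : 2 * b <= d -> b * d.+1 <= 2 ^ d.
Proof.
move=> bd; have -> : d = b + (d - b) by lia.
rewrite expnD; have h1 := ltn_expl b (isT : 1 < 2); have h2 := ltn_expl (d - b) (isT : 1 < 2).
case: b bd h1 h2 => [|b] bd h1 h2; first by rewrite mul0n.
have h3 : 2 * b.+1 <= 2 ^ b.+1 by rewrite expnS leq_mul2l /= ltn_expl.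
have h4 : (b.+1 + (d - b.+1)).+1 <= 2 * (d - b.+1).+1 by lia.
have := leq_mul h3 h2; apply: leq_trans; rewrite -mulnA mulnCA leq_mul2l /=.
by rewrite h4.
Qed.

Import Order.TTheory GRing.Theory Num.Theory.

Local Open Scope ring_scope.

(** As [mu] is at least [1/m], multiplication by [4 * m] clears the denominators. *)
Lemma sigma_ore_star_nat (R : realType) (T : finType) (D : rel T) (mu : R) (m : nat) x y :
  1 <= mu * m%:R -> x != y -> ~~ underlying D x y ->
  ((((3%:R / 4%:R + mu) * #|T|%:R)%:E <= sigma_ore_star R D)%E) ->
  ((3 * m + 4) * #|T| <= 4 * m * (stardeg D x + stardeg D y))%N.
Proof.
move=> mum xy nxy sg.
have : (((3%:R / 4%:R + mu) * #|T|%:R)%:E <=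
    ((stardeg D x + stardeg D y)%N%:R%:E : \bar R))%E.
  apply: le_trans sg _.
  exact: (@bigmin_le_cond _ _ _ _ (x, y) _
    (fun p : T * T => (stardeg D p.1 + stardeg D p.2)%N%:R%:E : \bar R)
    (introT andP (conj xy nxy))).
rewrite lee_fin natrD => h; rewrite -(ler_nat R).
rewrite natrM [(3 * m + 4)%:R]natrD [(3 * m)%:R]natrM [leRHS]natrM [(4 * m)%:R]natrM natrD.
have h4 : 0 <= 4%:R * m%:R :> R by rewrite mulr_ge0.
move: (ler_wpM2l h4 h); rewrite mulrA => h2.
apply: le_trans _ h2; rewrite ler_wpM2r // mulrDr.
have -> : 4%:R * m%:R * (3%:R / 4%:R) = 3%:R * m%:R :> R.
  by rewrite mulrAC mulrCA mulfV ?mulr1 // pnatr_eq0.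
by rewrite lerD2l -mulrA [m%:R * mu]mulrC ler_peMr.
Qed.

Theorem theorem1p4 (R : realType) (l : nat) (C : rel 'I_l) :
  (3 <= l)%N ->
  cycle_orientation C ->
  ~ consistently_directed C ->
  forall mu : R, 0 < mu ->
  exists (gamma : R) (n0 : nat), 0 < gamma /\
    forall (n : nat) (T : finType) (D : rel T),
      (n0 <= n)%N -> (l %| n)%N ->
      #|T| = n ->
      oriented_graph D ->
      (independence_number (underlying D))%:R <= gamma * n%:R ->
      (((3%:R / 4%:R + mu) * n%:R)%:E <= sigma_ore_star R D)%E ->
      has_factor C D.
Proof.
move=> l3 oC nC mu mu0.
(* The bound makes [1/m] at most [mu]; the successors ensure [2 <= m]. *)
pose m := (Num.bound mu^-1).+2.
have mum : 1 <= mu * m%:R.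
  rewrite -ler_pdivrMl // mulr1; apply: ltW; apply: lt_le_trans (archi_boundP _) _.
    by rewrite invr_ge0 ltW.
  by rewrite ler_nat; exact: leq_trans (leqnSn _) (leqnSn _).
(* With [d = n %/ b], the inequality [51 * l * l * (thr + l) <= d] is split in two: [e] makes the
   part with the independence number cost at most [n / 2], and the first summand of the threshold
   for [n] does so for the constant part. *)
pose b := factor_const l m; pose e := (102 * b * l ^ 4)%N.
have b0 : (0 < b)%N by rewrite /b /factor_const addn1.
have e0 : (0 < e)%N by rewrite muln_gt0 expn_gt0 (ltnW (ltnW l3)) muln_gt0 b0.
exists (e%:R^-1), (102 * b * l * l * (1 + l) + 2 * b * b)%N.
split; first by rewrite invr_gt0 ltr0n.
move=> n T D n0 ln nT oD aD sg; apply: tileable_factor.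
have {}aD : (e * independence_number (underlying D) <= n)%N.
  by move: aD; rewrite mulrC ler_pdivlMr ?ltr0n // -natrM ler_nat mulnC.
(* The second summand of the threshold gives [2 * b <= d], which [linear_leq_pow2] needs for
   [n <= 2 ^ d]. *)
have n1 : (102 * b * l * l * (1 + l) <= n)%N by apply: leq_trans n0; rewrite leq_addr.
have n2 : (2 * b * b <= n)%N by apply: leq_trans n0; rewrite leq_addl.
apply: (@tileable_setT l C m l3 oC nC isT T D n oD nT _ (n %/ b)) => //.
- by move=> x y xy nxy; rewrite -nT in sg *; exact: (sigma_ore_star_nat mum xy nxy sg).
- apply: leq_trans (_ : b * (n %/ b).+1 <= _)%N; last first.
    by apply: linear_leq_pow2; rewrite leq_divRL.
  by rewrite mulnC ltnW // ltn_ceil.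
- rewrite leq_divRL // /path_threshold.
  move: aD n1; rewrite /e !expnS expn0 muln1; clear.
  by move: (independence_number _) => a; nia.
- by rewrite mulnC leq_trunc_div.
Qed.
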